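(* Let $d\in\mathbb{N}$ and let $\mu=\sum_{j=1}^r\lambda_j\delta_{x_j}\in\mathcal{M}$ be a discrete measure with pairwise distinct $x_1,\dots,x_r\in\mathbb{T}^d$ and nonzero complex weights $\lambda_j$. Then, as $n\to\infty$, $$\frac{p_{1,n}}{\|p_{1,n}\|_{L^1}}\rightharpoonup\tilde\mu=\frac1r\sum_{j=1}^r\delta_{x_j}.$$
   Context: $\mathbb{T}^d=[0,1)^d$ is the torus, $kx=k_1x_1+\dots+k_dx_d$, $[n]=\{0,\dots,n\}^d$, $N=(n+1)^d$. $\mathcal{M}$ is the set of complex Borel measures $\mu$ on $\mathbb{T}^d$ of finite total variation with $\mu(\mathbb{T}^d)=1$. With $\hat\mu(k)=\int_{\mathbb{T}^d}e^{-2\pi i kx}\,\mathrm{d}\mu(x)$, the moment matrix is $T_n=(\hat\mu(k-\ell))_{k,\ell\in[n]}\in\mathbb{C}^{N\times N}$, with singular value decomposition $T_n=U_n\Sigma_nV_n^*$ and singular values in non-increasing order. With $e_n(x)=(e^{-2\pi i kx})_{k\in[n]}$ and $u_j^{(n)}(x)$ the $j$-th entry of $e_n(x)^*U_n$, define $$p_{1,n}(x)=\frac1N\sum_{j=1}^{\operatorname{rank}T_n}|u_j^{(n)}(x)|^2.$$ Weak convergence $q_n\rightharpoonup\nu$ means $\lim_{n\to\infty}\int_{\mathbb{T}^d}f(x)q_n(x)\,\mathrm{d}x=\int_{\mathbb{T}^d}f\,\mathrm{d}\nu$ for all continuous $f:\mathbb{T}^d\to\mathbb{C}$. *)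

(* Defs.v *)
From HB Require Import structures.
From mathcomp Require Import all_boot all_order all_algebra.
From mathcomp Require Import complex.
From mathcomp Require Import all_classical all_reals all_analysis.

Set Implicit Arguments.
Unset Strict Implicit.
Unset Printing Implicit Defensive.

Import Order.TTheory GRing.Theory Num.Theory.
Import numFieldNormedType.Exports.

Local Open Scope classical_set_scope.
Local Open Scope ring_scope.
Local Open Scope complex_scope.
Local Open Scope sesquilinear_scope.

Definition cons_pair (R : realType) (d : nat)
    (p : measurableTypeR R * d.-tuple R) : d.+1.-tuple R :=
  [tuple of p.1 :: p.2].

Section lebesgue_tuple.
Variable R : realType.

Lemma measurable_cons_pair d : measurable_fun [set: _] (@cons_pair R d).
Proof.
apply: (@measurable_cons _ _ _ R fst _ snd); last exact: measurable_snd.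
exact: (@measurable_fst _ _ (measurableTypeR R) (d.-tuple R)).
Qed.

HB.instance Definition _ d :=
  isMeasurableFun.Build _ _ _ _ (@cons_pair R d) (@measurable_cons_pair d).

Section cons.
Variables (d : nat) (m : {sigma_finite_measure set (d.-tuple R) -> \bar R}).

Definition lebesgue_cons : set (d.+1.-tuple R) -> \bar R :=
  pushforward (lebesgue_measure \x m)%E (@cons_pair R d).

Let lebesgue_cons0 : lebesgue_cons set0 = 0%E.
Proof. exact: measure0. Qed.

Let lebesgue_cons_ge0 A : (0 <= lebesgue_cons A)%E.
Proof. exact: measure_ge0. Qed.

Let lebesgue_cons_sigma_additive : semi_sigma_additive lebesgue_cons.
Proof. exact: measure_semi_sigma_additive. Qed.

HB.instance Definition _ := isMeasure.Build _ _ _ lebesgue_cons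
  lebesgue_cons0 lebesgue_cons_ge0 lebesgue_cons_sigma_additive.

Let lebesgue_cons_sigma_finite : sigma_finite setT lebesgue_cons.
Proof.
have /sigma_finiteP[F [TF ndF Foo]] := sigma_finiteT (@lebesgue_measure R).
have /sigma_finiteP[G [TG ndG Goo]] := sigma_finiteT m.
pose uncons (t : d.+1.-tuple R) : measurableTypeR R * d.-tuple R :=
  (thead t, [tuple of behead t]).
have muncons : measurable_fun [set: _] uncons.
  apply/measurable_fun_pairP; split; last exact: measurable_behead.
  exact: (@measurable_tnth _ R d.+1 ord0).
exists (fun k => uncons @^-1` (F k `*` G k)).
  rewrite -preimage_bigcup; apply/seteqP; split => // t _ /=.
  have: [set: measurableTypeR R] (thead t) by [].
  have: [set: d.-tuple R] [tuple of behead t] by [].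
  rewrite TG TF => -[k _ Gk] [l _ Fl]; exists (maxn k l) => //; split.
    by move: Fl; apply/subsetPset/ndF/leq_maxr.
  by move: Gk; apply/subsetPset/ndG/leq_maxl.
move=> k; have [mF Fk] := Foo k; have [mG Gk] := Goo k; split.
  by rewrite -[X in measurable X]setTI; apply: muncons => //; exact: measurableX.
rewrite /lebesgue_cons /pushforward -comp_preimage.
suff -> : uncons \o @cons_pair R d = id.
  by rewrite product_measure1E// lte_mul_pinfty// ge0_fin_numE.
by apply/funext => -[a t]; congr pair; apply/val_inj.
Qed.

HB.instance Definition _ := Measure_isSigmaFinite.Build _ _ _ lebesgue_cons
  lebesgue_cons_sigma_finite.

End cons.

Fixpoint lebesgue_tuple (d : nat) :
    {sigma_finite_measure set (d.-tuple R) -> \bar R} :=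
  match d with
  | 0 => dirac [tuple]
  | d'.+1 => lebesgue_cons (lebesgue_tuple d')
  end.

(* The torus T^d is the set [0, 1)^d of representatives inside R^d. *)
Definition torus (d : nat) : set (d.-tuple R) :=
  [set x | forall i, 0 <= tnth x i < 1].

Lemma measurable_torus d : measurable (@torus d).
Proof.
rewrite (_ : @torus d =
    \bigcap_(i in [set: 'I_d]) ((@tnth d R)^~ i @^-1` `[0, 1[%classic)).
  apply: fin_bigcap_measurable => // i _.
  rewrite -[X in measurable X]setTI.
  by apply: (@measurable_tnth _ R d i) => //; exact: measurable_itv.
apply/seteqP; split => [x Tx i _|x Tx i].
  by rewrite /= in_itv /=; exact: Tx.
by have := Tx i Logic.I; rewrite /= in_itv.
Qed.

Definition torus_measure (d : nat) : {measure set (d.-tuple R) -> \bar R} :=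
  mrestr (lebesgue_tuple d) (@measurable_torus d).

(* T^d carries the quotient topology of R^d / Z^d; [torus_proj] is the
   quotient map. *)
Definition torus_proj (d : nat) (y : 'rV[R]_d) : d.-tuple R :=
  [tuple y 0 i - (Num.floor (y 0 i))%:~R | i < d].

(* [R[i]^o] is [R[i]] with the topology of its norm. *)
Definition torus_continuous (d : nat) (f : d.-tuple R -> R[i]^o) : Prop :=
  continuous (f \o @torus_proj d).

End lebesgue_tuple.

Arguments torus {R} d.
Arguments torus_measure {R} d.

Section integrals.
Context {disp : measure_display} {T : measurableType disp} {R : realType}.

Definition cintegral (m : {measure set T -> \bar R}) (D : set T)
    (f : T -> R[i]) : R[i] :=
  (\int[m]_(x in D) complex.Re (f x)) +i* (\int[m]_(x in D) complex.Im (f x)).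

Lemma hahn_exists (nu : {charge set T -> \bar R}) :
  exists PN : set T * set T, hahn_decomposition nu PN.1 PN.2.
Proof. by have [P [N nuPN]] := Hahn_decomposition nu; exists (P, N). Qed.

(* Independent of the chosen Hahn decomposition. *)
Definition charge_integral (nu : {charge set T -> \bar R}) (D : set T)
    (f : T -> R) : R :=
  let nuPN := projT2 (cid (hahn_exists nu)) in
  (\int[jordan_pos nuPN]_(x in D) f x) - (\int[jordan_neg nuPN]_(x in D) f x).

(* Charges take finite values, so such a pair is exactly a complex measure,
   and its total variation is finite. *)
Record cmeasure := CMeasure {
  cm_re : {charge set T -> \bar R};
  cm_im : {charge set T -> \bar R}
}.

Definition cm_val (mu : cmeasure) (A : set T) : R[i] :=
  fine (cm_re mu A) +i* fine (cm_im mu A).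

Definition cm_integral (mu : cmeasure) (D : set T) (f : T -> R[i]) : R[i] :=
  (charge_integral (cm_re mu) D (fun x => complex.Re (f x)) -
   charge_integral (cm_im mu) D (fun x => complex.Im (f x))) +i*
  (charge_integral (cm_re mu) D (fun x => complex.Im (f x)) +
   charge_integral (cm_im mu) D (fun x => complex.Re (f x))).

Definition charge_add (n1 n2 : {charge set T -> \bar R}) :
  {charge set T -> \bar R} := cadd n1 n2.

Definition discrete_charge (r : nat) (c : 'I_r -> R) (x : 'I_r -> T) :
    {charge set T -> \bar R} :=
  \big[charge_add/(czero : {charge set T -> \bar R})]_(j < r)
    (cscale (c j) (charge_of_finite_measure (dirac (x j)))
       : {charge set T -> \bar R}).

Definition discrete_cmeasure (r : nat) (lam : 'I_r -> R[i]) (x : 'I_r -> T) :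
    cmeasure :=
  CMeasure (discrete_charge (fun j => complex.Re (lam j)) x)
           (discrete_charge (fun j => complex.Im (lam j)) x).

Lemma discrete_chargeE (r : nat) (c : 'I_r -> R) (x : 'I_r -> T) (A : set T) :
  discrete_charge c x A = (\sum_(j < r) c j * \1_A (x j))%:E.
Proof.
rewrite /discrete_charge -sumEFin.
elim/big_ind2 : _ => [//|n1 a n2 b <- <- //|j _].
by rewrite EFinM.
Qed.

Lemma discrete_cmeasureE (r : nat) (lam : 'I_r -> R[i]) (x : 'I_r -> T)
    (A : set T) :
  cm_val (discrete_cmeasure lam x) A = \sum_(j < r) lam j * (\1_A (x j))%:C.
Proof.
rewrite /cm_val /= !discrete_chargeE /=.
apply: (big_rec3 (fun (u v : R) (z : R[i]) => u +i* v = z)) => // j u v z _ <-.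
by case: (lam j) => a b; apply/eqP; rewrite eq_complex /= !mulr0 subr0 add0r !eqxx.
Qed.

End integrals.

Arguments cmeasure {disp} T R.

Section moments.
Variables (R : realType) (d : nat).

Definition expi (t : R) : R[i] := cos t +i* sin t.

Definition dotkx (k : d.-tuple int) (x : d.-tuple R) : R :=
  \sum_(i < d) (tnth k i)%:~R * tnth x i.

(* Membership in the set M; only the values of [mu] on Borel subsets of the
   torus matter throughout. *)
Definition normalized (mu : cmeasure (d.-tuple R) R) : Prop :=
  cm_val mu (torus d) = 1.

Definition moment (mu : cmeasure (d.-tuple R) R) (k : d.-tuple int) : R[i] :=
  cm_integral mu (torus d) (fun x => expi (- (2 * pi * dotkx k x))).

Definition dimN (n : nat) : nat := (n.+1 ^ d)%N.

Lemma card_index (n : nat) : #|{: d.-tuple 'I_n.+1}| = dimN n.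
Proof. by rewrite card_tuple card_ord. Qed.

(* Matrices over [n] = {0, ..., n}^d are indexed through an enumeration of
   {0, ..., n}^d. *)
Definition multi_index (n : nat) (a : 'I_(dimN n)) : d.-tuple int :=
  map_tuple (fun k : 'I_n.+1 => (k : nat)%:Z)
    (enum_val (cast_ord (esym (card_index n)) a)).

Definition index_sub (k l : d.-tuple int) : d.-tuple int :=
  [tuple tnth k i - tnth l i | i < d].

Definition moment_matrix (mu : cmeasure (d.-tuple R) R) (n : nat) :
    'M[R[i]]_(dimN n) :=
  \matrix_(a, b) moment mu (index_sub (multi_index a) (multi_index b)).

Definition evec (n : nat) (x : d.-tuple R) : 'cV[R[i]]_(dimN n) :=
  \col_a expi (- (2 * pi * dotkx (multi_index a) x)).

Definition p1 (mu : cmeasure (d.-tuple R) R) (n : nat)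
    (U : 'M[R[i]]_(dimN n)) (x : d.-tuple R) : R :=
  (dimN n)%:R^-1 *
  \sum_(j < dimN n | (j < \rank (moment_matrix mu n))%N)
    Normc.normc (((evec n x)^t* *m U) 0 j) ^+ 2.

Definition L1norm (q : d.-tuple R -> R) : R :=
  fine 'N[torus_measure d]_1 [EFin \o q]%E.

Definition weak_cvg (q : nat -> d.-tuple R -> R)
    (nu : cmeasure (d.-tuple R) R) : Prop :=
  forall f : d.-tuple R -> R[i]^o, torus_continuous f ->
    (fun n => cintegral (torus_measure d) (torus d)
       (fun x => f x * (q n x)%:C) : R[i]^o) @ \oo
    --> (cm_integral nu (torus d) f : R[i]^o).

End moments.

Definition is_svd (R : realType) (N : nat) (A U V : 'M[R[i]]_N)
    (s : 'I_N -> R) : Prop :=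
  [/\ U \is unitarymx, V \is unitarymx,
      forall j, 0 <= s j,
      forall i j : 'I_N, (i <= j)%N -> s j <= s i
    & A = U *m diag_mx (\row_j (s j)%:C) *m V^t*].

(* Main.v *)
(** Write [Q_n y] for the squared norm of the orthogonal projection of [e_n(y)] onto
    the range of [T_n]. Since [T_n = E L E^*], where the columns of [E] are the
    [e_n(x_j)] and [L] is diagonal and invertible, [T_n] has rank [r] and range
    spanned by the [e_n(x_j)] as soon as these are independent; by Parseval,
    [Q_n] has integral [r], so the normalized density is [Q_n / r].
    The normalized Gram matrix [E^* E / N] tends to the identity at rate [1 / n],
    whence [sum_j F_j <= (1 + O(1/n)) Q_n], where
    [F_j(y) = |<e_n(x_j), e_n(y)>|^2 / N] is the Fejer kernel at [x_j]. Both sides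
    have integral [r] up to [O(1/n)], so [Q_n - sum_j F_j] tends to [0] in [L^1],
    and it suffices to show that [F_j dy] tends weakly to the Dirac mass at [x_j].
    As in Korovkin's theorem, this only requires
    [int (1 - cos 2 pi (y_i - x_i)) F(y) dy = O(1/n)], which is again Parseval,
    because [1 - z_i] telescopes the geometric sum in the [i]-th variable. *)

Require Import Defs.
From mathcomp Require Import all_boot all_order all_algebra.
From mathcomp Require Import complex ring lra.
From mathcomp Require Import all_classical all_reals all_analysis.
From mathcomp Require Import measurable_realfun.

Set Implicit Arguments.
Unset Strict Implicit.
Unset Printing Implicit Defensive.

Import Order.TTheory GRing.Theory Num.Theory.
Import numFieldNormedType.Exports.

Local Open Scope classical_set_scope.
Local Open Scope ring_scope.
Local Open Scope complex_scope.
Local Open Scope sesquilinear_scope.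

(** * Integrals of cosines over the unit cube *)

Section trigonometric_integrals.
Variable R : realType.
Implicit Types (phi : R) (d : nat).

Lemma sinDint (a : R) (k : int) : sin (a + 2 * pi * k%:~R) = sin a.
Proof.
have sinDnat b (n : nat) : sin (b + 2 * pi * n%:R) = sin b :> R.
  by rewrite mulr_natr mulr_natl; apply: periodicn; exact: sinD2pi.
case: k => n; first exact: sinDnat.
rewrite NegzE rmorphN /= mulrN -[RHS](congr1 sin (subrK (2 * pi * n.+1%:R) a)).
by rewrite sinDnat.
Qed.

Lemma cosDint (a : R) (k : int) : cos (a + 2 * pi * k%:~R) = cos a.
Proof. by rewrite -!sinDpihalf addrAC sinDint. Qed.

(** For [k != 0] the sine in the antiderivative takes equal values at 0 and 1, by [sinDint]. The
    phase [phi] serves twice: it absorbs the first coordinate in the induction on the dimension, and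
    [pi / 2] turns cosines into sines. *)
Lemma integral_1Dcos_01 (k : int) phi :
  (\int[lebesgue_measure]_(t in `[0%R, 1%R[)
     (1 + cos (2 * pi * (k%:~R * t) + phi))%:E =
   (1 + (k == 0)%:R * cos phi)%:E)%E.
Proof.
have cvfun (t : R) :
    {for t, continuous (fun t : R => 1 + cos (2 * pi * (k%:~R * t) + phi))}.
  apply: continuousD; first exact: cst_continuous.
  apply: (@continuous_comp _ _ _ _ (@cos R)); last exact: continuous_cos.
  apply: continuousD; last exact: cst_continuous.
  by do 2 (apply: continuousM; first exact: cst_continuous).
rewrite integral_itv_bndo_bndc; last first.
  apply/measurable_EFinP/measurable_funTS.
  exact: continuous_measurable_fun.
have [->|k0] := eqVneq k 0.
  under eq_integral do rewrite mul0r mulr0 add0r.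
  by rewrite integral_cst//= lebesgue_measure_itv /= lte_fin ltr01 oppr0
    adde0 mule1 mul1r.
have c0 : 2 * pi * k%:~R != 0 :> R.
  by rewrite mulf_neq0 ?mulf_neq0 ?intr_eq0 ?pnatr_eq0// gt_eqF// pi_gt0.
pose F (t : R) := t + (2 * pi * k%:~R)^-1 * sin (2 * pi * (k%:~R * t) + phi).
have dF (t : R) : is_derive t 1 F (1 + cos (2 * pi * (k%:~R * t) + phi)).
  have dlin : is_derive t 1 (fun t : R => 2 * pi * (k%:~R * t) + phi)
      (2 * pi * k%:~R).
    rewrite (_ : (fun _ => _) = ((2 * pi * k%:~R) \*: id) \+ cst phi); last first.
      by apply/funext => u; rewrite /= mulrA.
    by apply: is_derive_eq; rewrite addr0 /GRing.scale /= mulr1.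
  have dsin := is_derive1_comp (is_derive_sin _) dlin.
  have dZ := is_deriveZ (2 * pi * k%:~R)^-1 dsin.
  apply: (@is_derive_eq _ _ _ _ _ _ _ _ (is_deriveD (is_derive_id t 1) dZ)).
  by rewrite /GRing.scale /= mulrCA mulVf // mulr1.
rewrite (@continuous_FTC2 _ _ F)//.
- rewrite /F !mulr0 mulr1 !add0r [_ * k%:~R + phi]addrC sinDint.
  by rewrite -EFinB addrK mul0r addr0.
- by apply: continuous_subspaceT => t; exact: cvfun.
- split.
  + by move=> t _; have [] := dF t.
  + apply: cvg_at_right_filter; apply/differentiable_continuous/derivable1_diffP.
    by have [] := dF 0.
  + apply: cvg_at_left_filter; apply/differentiable_continuous/derivable1_diffP.
    by have [] := dF 1.
- by move=> t _; rewrite derive1E; have [] := dF t.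
Qed.


Lemma measurable_dotkx d (k : d.-tuple int) :
  measurable_fun [set: d.-tuple R] (@dotkx R d k).
Proof.
apply: measurable_sum => i; apply: measurable_funM; first exact: measurable_cst.
exact: measurable_tnth.
Qed.

Lemma measurable_cos_dotkx d (k : d.-tuple int) phi :
  measurable_fun [set: d.-tuple R] (fun y => cos (2 * pi * dotkx k y + phi)).
Proof.
apply: (measurableT_comp (f := @cos R)).
  exact: continuous_measurable_fun (@continuous_cos R).
apply: measurable_funD; last exact: measurable_cst.
by apply: measurable_funM; [exact: measurable_cst|exact: measurable_dotkx].
Qed.

Lemma dotkx_cons d (k0 : int) (k : d.-tuple int) (t : R) (y : d.-tuple R) :
  dotkx [tuple of k0 :: k] (cons_pair (t, y)) = k0%:~R * t + dotkx k y.
Proof.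
rewrite /dotkx big_ord_recl; congr (_ + _).
by apply: eq_bigr => i _; rewrite !tnthS.
Qed.

Lemma torus_cons d (t : R) (y : d.-tuple R) :
  torus d.+1 (cons_pair (t, y)) <-> (t \in `[0, 1[) /\ torus d y.
Proof.
rewrite in_itv /=; split=> [T|[t01 T] i].
  split; first exact: (T ord0).
  by move=> i; have := T (lift ord0 i); rewrite tnthS.
by case: (unliftP ord0 i) => [j|] ->; rewrite ?tnthS //; exact: T.
Qed.

(* The constant [1] makes the integrand nonnegative, so that Tonelli applies. *)
Lemma integral_1Dcos_torus d (k : d.-tuple int) phi :
  (\int[lebesgue_tuple R d]_(y in torus d)
     (1 + cos (2 * pi * dotkx k y + phi))%:E =
   (1 + [forall i, tnth k i == 0%R]%:R * cos phi)%:E)%E.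
Proof.
elim: d => [|d IH] in k phi *.
  rewrite (_ : torus 0 = setT); last by apply/seteqP; split => // y _ [].
  have -> : [forall i, tnth k i == 0%R] by apply/forallP => -[].
  rewrite /= integral_dirac ?diracT ?mul1e//=; last first.
    apply/measurable_EFinP; apply: measurable_funD; first exact: measurable_cst.
    exact: measurable_cos_dotkx.
  by rewrite /dotkx big_ord0 mulr0 add0r mul1r.
case/tupleP: k => k0 k.
pose g (y : d.+1.-tuple R) :=
  (1 + cos (2 * pi * dotkx [tuple of k0 :: k] y + phi))%:E.
have g0 y : (0 <= g y)%E by rewrite lee_fin -lerBlDl sub0r cos_geN1.
have mg : measurable_fun setT g.
  apply/measurable_EFinP; apply: measurable_funD; first exact: measurable_cst.
  exact: measurable_cos_dotkx.
have mcons : measurable_fun setT (@cons_pair R d) by exact: measurable_cons_pair.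
have mT : measurable (@cons_pair R d @^-1` torus d.+1).
  by rewrite -[X in measurable X]setTI; apply: mcons => //; exact: measurable_torus.
have mgT : measurable_fun (torus d.+1) g by exact: measurable_funTS.
have gT : {in torus d.+1, forall y, (0 <= g y)%E} by move=> y _; exact: g0.
rewrite /= /lebesgue_cons
  (ge0_integral_pushforward mcons _ (@measurable_torus R d.+1) mgT gT).
pose G := (g \o @cons_pair R d) \_ (@cons_pair R d @^-1` torus d.+1).
have mG : measurable_fun setT G.
  apply: (measurable_restrictT _ mT).1; apply: measurable_funTS.
  exact: (measurableT_comp mg mcons).
rewrite integral_mkcond (@fubini_tonelli1 _ _ _ _ _ _ _ G)//; last first.
  by move=> z; rewrite /G patchE; case: ifP => _; [exact: g0|exact: lexx].
transitivity (\int[lebesgue_measure]_(t in `[0%R, 1%R[)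
  (1 + [forall i, tnth k i == 0%R]%:R * cos (2 * pi * (k0%:~R * t) + phi))%:E)%E.
  rewrite [RHS]integral_mkcond; apply: eq_integral => t _.
  rewrite patchE; case: ifPn => [|] t01.
    (* The induction hypothesis is used from right to left, with [2 * pi * (k0%:~R * t) + phi] as
       the phase. *)
    rewrite -IH [RHS]integral_mkcond /fubini_F; apply: eq_integral => y _.
    rewrite /G !patchE.
    have -> : ((t, y) \in @cons_pair R d @^-1` torus d.+1) = (y \in torus d).
      apply/idP/idP => [|yT].
        by rewrite inE /= => /torus_cons[_ yT]; rewrite inE.
      by rewrite inE; apply/torus_cons; rewrite !inE in t01 yT.
    case: ifP => // _; rewrite /= /g dotkx_cons mulrDr -addrA addrCA.
    by rewrite addrA [X in X + phi]addrC.
  rewrite /fubini_F integral0_eq// => y _.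
  rewrite /G patchE; case: ifPn => //; rewrite inE /= => /torus_cons[t01' _].
  by move: t01; rewrite notin_setE /= t01'.
(* If some frequency of the tail is nonzero, the inner integral is already the constant 1; otherwise
   the one-dimensional formula applies. *)
case: (boolP [forall i, tnth k i == 0]) => [/forallP k_0|k_n0].
  under eq_integral do rewrite mul1r.
  rewrite integral_1Dcos_01; congr ((1 + (nat_of_bool _)%:R * _)%:E).
  apply/idP/forallP => [k00 i|/(_ ord0)//].
  by case: (unliftP ord0 i) => [j|] ->; rewrite ?tnthS ?k_0.
under eq_integral do rewrite mul0r addr0.
rewrite integral_cst//= lebesgue_measure_itv /= lte_fin ltr01 oppr0 adde0 mule1.
rewrite (_ : [forall i, _] = false) ?mul0r ?addr0//.
apply: contraNF k_n0 => /forallP k_0; apply/forallP => i.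
by have := k_0 (lift ord0 i); rewrite tnthS.
Qed.

End trigonometric_integrals.

(** * Moduli, real parts and the exponential [expi] *)

Section complex_modulus.
Variable R : realType.
Implicit Types (a b t : R) (z w : R[i]).
Local Notation normc := Normc.normc.

Lemma normc2E z : normc z ^+ 2 = complex.Re z ^+ 2 + complex.Im z ^+ 2.
Proof. by case: z => u v; rewrite /= sqr_sqrtr ?addr_ge0 ?sqr_ge0. Qed.

Lemma normc_ge0 z : 0 <= normc z.
Proof. by case: z => u v; exact: sqrtr_ge0. Qed.

Lemma normc2_conj z : (normc z ^+ 2)%:C = z * z^*%C.
Proof. by rewrite rmorphXn; exact: sqr_normc. Qed.

Lemma normc_sqr z : normc z ^+ 2 = complex.Re (z * z^*%C).
Proof. by rewrite -normc2_conj. Qed.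

Lemma normc_conjc z : normc z^*%C = normc z.
Proof. by case: z => u v /=; rewrite sqrrN. Qed.

Lemma normc_sum (I : Type) (s : seq I) (P : pred I) (F : I -> R[i]) :
  normc (\sum_(i <- s | P i) F i) <= \sum_(i <- s | P i) normc (F i).
Proof.
elim/big_ind2 : _ => [|z a w b za wb|//]; first by rewrite Normc.normc0.
by rewrite (le_trans (le_normcD _ _))// lerD.
Qed.

Lemma Re_sum (I : Type) (s : seq I) (P : pred I) (F : I -> R[i]) :
  complex.Re (\sum_(i <- s | P i) F i) = \sum_(i <- s | P i) complex.Re (F i).
Proof. by apply: (big_morph _ _ erefl) => -[? ?] [? ?]. Qed.

Lemma Im_sum (I : Type) (s : seq I) (P : pred I) (F : I -> R[i]) :
  complex.Im (\sum_(i <- s | P i) F i) = \sum_(i <- s | P i) complex.Im (F i).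
Proof. by apply: (big_morph _ _ erefl) => -[? ?] [? ?]. Qed.

Lemma expiD a b : expi (a + b) = expi a * expi b.
Proof.
by apply/eqP; rewrite eq_complex /= sinD cosD eqxx /= addrC.
Qed.

Lemma expi0 : expi 0 = 1 :> R[i].
Proof. by rewrite /expi sin0 cos0. Qed.

Lemma expiN t : expi (- t) = (expi t)^*%C.
Proof. by rewrite /expi sinN cosN. Qed.

Lemma normc_expi t : normc (expi t) = 1.
Proof. by rewrite /= cos2Dsin2 sqrtr1. Qed.

Lemma expi_sum (I : Type) (s : seq I) (P : pred I) (F : I -> R) :
  expi (\sum_(i <- s | P i) F i) = \prod_(i <- s | P i) expi (F i).
Proof. exact: (big_morph _ expiD expi0). Qed.

Lemma expiMn t n : expi (t * n%:R) = expi t ^+ n.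
Proof.
by elim: n => [|n IH]; rewrite ?mulr0 ?expi0// -addn1 natrD mulrDr mulr1 expiD IH exprD.
Qed.

(** The sine is written as a cosine of phase [pi / 2], and the phase 0 is kept explicit, so that
    both terms match the lemmas on cosines. *)
Lemma Re_mul_expi z t :
  complex.Re (z * expi t) =
  complex.Re z * cos (t + 0) + complex.Im z * cos (t + pi / 2).
Proof. by case: z => u v /=; rewrite cosDpihalf addr0 mulrN. Qed.

End complex_modulus.

(** * Integration on the torus and Parseval's identity *)

Section torus_integral.
Variables (R : realType) (d : nat).
Implicit Types (f g : d.-tuple R -> R) (k : d.-tuple int).
Local Notation normc := Normc.normc.

Lemma dotkxB k l (y : d.-tuple R) :
  dotkx (index_sub k l) y = dotkx k y - dotkx l y.
Proof.
rewrite /dotkx -sumrB; apply: eq_bigr => i _.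
by rewrite tnth_mktuple rmorphB /= mulrBl.
Qed.

Lemma integral_torus_measure (f : d.-tuple R -> \bar R) :
  (\int[torus_measure d]_(y in torus d) f y =
   \int[lebesgue_tuple R d]_(y in torus d) f y)%E.
Proof.
apply: eq_measure_integral => A mA AT.
by rewrite /torus_measure /= /mrestr; congr (lebesgue_tuple R d _); exact: setIidl.
Qed.

(** At frequency 0 and phase [pi / 2] the cosine vanishes, so the cosine integral computes the total
    mass. *)
Lemma torus_measure_torus : torus_measure d (@torus R d) = 1%E.
Proof.
rewrite -[LHS]mul1e -integral_cst; last exact: measurable_torus.
rewrite integral_torus_measure.
have := integral_1Dcos_torus [tuple 0 | i < d] (pi / 2 : R).
rewrite cos_pihalf mulr0 addr0 => e1; rewrite -[RHS]e1; apply: eq_integral => y _.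
rewrite /dotkx big1 => [|i _]; last by rewrite tnth_mktuple mul0r.
by rewrite mulr0 add0r cos_pihalf addr0.
Qed.

(** A class closed under sums and products whose members are integrable because the torus has finite
    measure; it settles all integrability side conditions below. *)
Definition torus_bounded_measurable f :=
  measurable_fun (torus d) f /\ exists M, forall y, torus d y -> `|f y| <= M.
Local Notation tbm := torus_bounded_measurable.

Lemma tbm_integrable f : tbm f ->
  (torus_measure d).-integrable (torus d) (EFin \o f).
Proof.
move=> [mf [M fM]]; apply: measurable_bounded_integrable => //.
- exact: measurable_torus.
- by apply: (@le_lt_trans _ _ 1%E); rewrite ?ltry//= torus_measure_torus.
- exists M; split; first exact: num_real.
  by move=> x Mx y Ty; exact: le_trans (fM _ Ty) (ltW Mx).
Qed.

Lemma tbm_cst (c : R) : tbm (fun=> c).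
Proof. by split; [exact: measurable_cst|exists `|c|]. Qed.

Lemma tbmD f g : tbm f -> tbm g -> tbm (fun y => f y + g y).
Proof.
move=> [mf [M fM]] [mg [N gN]]; split; first exact: measurable_funD.
by exists (M + N) => y Ty; rewrite (le_trans (ler_normD _ _))// lerD// ?fM ?gN.
Qed.

Lemma tbmM f g : tbm f -> tbm g -> tbm (fun y => f y * g y).
Proof.
move=> [mf [M fM]] [mg [N gN]]; split; first exact: measurable_funM.
by exists (M * N) => y Ty; rewrite normrM ler_pM// ?fM ?gN.
Qed.

Lemma tbmB f g : tbm f -> tbm g -> tbm (fun y => f y - g y).
Proof.
move=> bf bg; rewrite (_ : (fun _ => _) = (fun y => f y + (-1) * g y)).
  by apply: tbmD => //; apply: tbmM => //; exact: tbm_cst.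
by apply/funext => y; rewrite mulN1r.
Qed.

Lemma tbm_sum (I : Type) (s : seq I) (F : I -> d.-tuple R -> R) :
  (forall i, tbm (F i)) -> tbm (fun y => \sum_(i <- s) F i y).
Proof.
move=> bF; elim: s => [|i s IH].
  by under eq_fun do rewrite big_nil; exact: tbm_cst.
by under eq_fun do rewrite big_cons; apply: tbmD.
Qed.

Lemma tbm_cos k (phi : R) : tbm (fun y => cos (2 * pi * dotkx k y + phi)).
Proof.
split; first by apply: measurable_funTS; exact: measurable_cos_dotkx.
by exists 1 => y _; rewrite ler_norml cos_geN1 cos_le1.
Qed.

Definition torus_integral f : R := \int[torus_measure d]_(y in torus d) f y.
Local Notation tint := torus_integral.

Lemma torus_integral_cst (c : R) : tint (fun=> c) = c.
Proof.
rewrite /tint Rintegral_cst; last exact: measurable_torus.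
by rewrite torus_measure_torus mulr1.
Qed.

Lemma torus_integralD f g : tbm f -> tbm g ->
  tint (fun y => f y + g y) = tint f + tint g.
Proof.
move=> bf bg; apply: RintegralD; first exact: measurable_torus.
- exact: tbm_integrable.
- exact: tbm_integrable.
Qed.

Lemma torus_integralZ (c : R) f : tbm f -> tint (fun y => c * f y) = c * tint f.
Proof.
move=> bf; apply: RintegralZl; first exact: measurable_torus.
exact: tbm_integrable.
Qed.

Lemma torus_integralB f g : tbm f -> tbm g ->
  tint (fun y => f y - g y) = tint f - tint g.
Proof.
move=> bf bg; apply: RintegralB; first exact: measurable_torus.
- exact: tbm_integrable.
- exact: tbm_integrable.
Qed.

Lemma torus_integral_sum (I : Type) (s : seq I) (F : I -> d.-tuple R -> R) :
  (forall i, tbm (F i)) ->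
  tint (fun y => \sum_(i <- s) F i y) = \sum_(i <- s) tint (F i).
Proof.
move=> bF; elim: s => [|i s IH].
  by under eq_fun do rewrite big_nil; rewrite torus_integral_cst big_nil.
under eq_fun do rewrite big_cons.
by rewrite torus_integralD ?IH ?big_cons//; exact: tbm_sum.
Qed.

Lemma le_torus_integral f g : tbm f -> tbm g ->
  (forall y, torus d y -> f y <= g y) -> tint f <= tint g.
Proof.
move=> bf bg fg; apply: le_Rintegral => //; first exact: measurable_torus.
- exact: tbm_integrable.
- exact: tbm_integrable.
Qed.

Lemma le_norm_torus_integral f g : tbm f -> tbm g ->
  (forall y, torus d y -> `|f y| <= g y) -> `|tint f| <= tint g.
Proof.
move=> bf bg fg; rewrite ler_norml; apply/andP; split.
  rewrite -mulN1r -torus_integralZ//; apply: le_torus_integral => //.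
    by apply: tbmM => //; exact: tbm_cst.
  by move=> y /fg; rewrite ler_norml mulN1r => /andP[].
apply: le_torus_integral => // y /fg; exact/le_trans/ler_norm.
Qed.

Lemma torus_integral_cos k (phi : R) :
  tint (fun y => cos (2 * pi * dotkx k y + phi)) =
  [forall i, tnth k i == 0]%:R * cos phi.
Proof.
(* Integrability being known, linearity removes the constant that was added for Tonelli. *)
have := torus_integralD (tbm_cst 1) (tbm_cos k phi).
rewrite torus_integral_cst {1}/tint /Rintegral integral_torus_measure.
by rewrite integral_1Dcos_torus /= => /addrI <-.
Qed.

Definition trigsum (I : finType) (K : I -> d.-tuple int) (c : I -> R[i])
  (y : d.-tuple R) : R[i] := \sum_a c a * expi (2 * pi * dotkx (K a) y).

(** The expansion into real parts of single exponentials reduces measurability, boundedness and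
    integration of the square to the case of cosines. *)
Lemma normc2_trigsum (I : finType) (K : I -> d.-tuple int) (c : I -> R[i]) y :
  normc (trigsum K c y) ^+ 2 =
  \sum_a \sum_b complex.Re (c a * (c b)^*%C *
                   expi (2 * pi * dotkx (index_sub (K a) (K b)) y)).
Proof.
rewrite normc_sqr /trigsum rmorph_sum /= mulr_suml Re_sum.
apply: eq_bigr => a _; rewrite mulr_sumr Re_sum.
apply: eq_bigr => b _; rewrite (rmorphM conjc) [X in _ * (_ * X)](esym (expiN _)).
rewrite mulrACA -expiD.
by rewrite dotkxB mulrBr.
Qed.

Lemma tbm_Re_expi (z : R[i]) k :
  tbm (fun y => complex.Re (z * expi (2 * pi * dotkx k y))).
Proof.
under eq_fun do rewrite Re_mul_expi.
by apply: tbmD; apply: tbmM; [exact: tbm_cst|exact: tbm_cos|exact: tbm_cst|exact: tbm_cos].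
Qed.

Lemma torus_integral_Re_expi (z : R[i]) k :
  tint (fun y => complex.Re (z * expi (2 * pi * dotkx k y))) =
  [forall i, tnth k i == 0]%:R * complex.Re z.
Proof.
under [X in tint X]eq_fun do rewrite Re_mul_expi.
rewrite torus_integralD ?torus_integralZ ?torus_integral_cos;
  try (by exact: tbm_cos);
  try (by apply: tbmM; [exact: tbm_cst|exact: tbm_cos]).
by rewrite cos0 cos_pihalf !mulr0 addr0 mulr1 mulrC.
Qed.

Lemma tbm_normc2_trigsum (I : finType) (K : I -> d.-tuple int) (c : I -> R[i]) :
  tbm (fun y => normc (trigsum K c y) ^+ 2).
Proof.
under eq_fun do rewrite normc2_trigsum.
by do 2 (apply: tbm_sum => ?); exact: tbm_Re_expi.
Qed.

Lemma measurable_normc2_trigsum (I : finType) (K : I -> d.-tuple int)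
    (c : I -> R[i]) :
  measurable_fun [set: d.-tuple R] (fun y => normc (trigsum K c y) ^+ 2).
Proof.
under eq_fun do rewrite normc2_trigsum.
do 2 apply: measurable_sum => ?; under eq_fun do rewrite Re_mul_expi.
by apply: measurable_funD; apply: measurable_funM => //; exact: measurable_cos_dotkx.
Qed.

(** A pair [a != b] contributes the frequency [K a - K b], nonzero by injectivity, whose integral
    vanishes; only the diagonal remains. *)
Lemma parseval (I : finType) (K : I -> d.-tuple int) (c : I -> R[i]) :
  injective K ->
  tint (fun y => normc (trigsum K c y) ^+ 2) = \sum_a normc (c a) ^+ 2.
Proof.
move=> Kinj; under [X in tint X]eq_fun do rewrite normc2_trigsum.
rewrite torus_integral_sum => [|a]; last first.
  by apply: tbm_sum => b; exact: tbm_Re_expi.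
apply: eq_bigr => a _; rewrite torus_integral_sum => [|b]; last exact: tbm_Re_expi.
rewrite (bigD1 a)//= big1 ?addr0 => [|b ba]; rewrite torus_integral_Re_expi.
  rewrite (_ : [forall _, _]) ?mul1r ?normc_sqr//.
  by apply/forallP => i; rewrite tnth_mktuple subrr.
rewrite (_ : [forall _, _] = false) ?mul0r//.
apply: contraNF ba => /forallP Kab; apply/eqP/Kinj/eq_from_tnth => i.
by have := Kab i; rewrite tnth_mktuple subr_eq0 eq_sym => /eqP.
Qed.

End torus_integral.

(** * Integrals against discrete charges *)

Section discrete_charges.
Context {disp : measure_display} {T : measurableType disp} {R : realType}.
Variables (r : nat) (x : 'I_r -> T) (D : set T) (h : T -> R).
Hypotheses (xinj : injective x) (mx : forall j, measurable [set x j]).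
Hypotheses (mD : measurable D) (Dx : forall j, D (x j)) (mh : measurable_fun D h).

(** Off a null set, [h] coincides with a combination of indicators of the atoms. *)
Lemma Rintegral_finite_support (m : {finite_measure set T -> \bar R}) :
  m (~` (\bigcup_j [set x j])) = 0%E ->
  \int[m]_(y in D) h y = \sum_(j < r) h (x j) * fine (m [set x j]).
Proof.
move=> mS0.
have mS : measurable (\bigcup_j [set x j]) by exact: fin_bigcup_measurable.
pose g y := \sum_(j < r) h (x j) * \1_[set x j] y.
have int1 j : m.-integrable D (EFin \o \1_[set x j]).
  by apply: (integrableS measurableT) => //; exact: integrable_indic.
have intg j : m.-integrable D (EFin \o (fun y => h (x j) * \1_[set x j] y)).
  have := @integrableZl _ _ _ m D mD (h (x j)) (EFin \o \1_[set x j]).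
  by apply.
have mg : measurable_fun D g.
  apply: measurable_sum => j; apply: measurable_funM; first exact: measurable_cst.
  exact: measurable_indic.
have -> : \int[m]_(y in D) h y = \int[m]_(y in D) g y.
  congr fine; apply: ae_eq_integral => //; try exact/measurable_EFinP.
  exists (~` (\bigcup_j [set x j])); split => //; first exact: measurableC.
  move=> y /= /not_implyP[Dy hg] [j _ /= yE]; apply: hg; congr EFin.
  rewrite yE /g (bigD1 j)//= indicE mem_set// mulr1 big1 ?addr0// => i ij.
  rewrite indicE memNset ?mulr0//= => /xinj ji.
  by rewrite ji eqxx in ij.
rewrite /Rintegral /g.
under eq_integral do rewrite -sumEFin.
rewrite integral_sum// -sum_fine; last first.
  by move=> j _; exact: (integrable_fin_num mD (intg j)).
apply: eq_bigr => j _.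
under eq_integral do rewrite EFinM.
rewrite integralZl//=; last exact: int1.
rewrite integral_indic//.
by rewrite (_ : [set x j] `&` D = [set x j]) ?fineM ?fin_num_measure//;
  apply: setIidl => _ /= ->.
Qed.

(** Whichever Hahn decomposition was chosen, each atom lies in exactly one of [P] and [N], so [c j]
    is counted once and with its own sign. *)
Lemma charge_integral_discrete (c : 'I_r -> R) :
  charge_integral (discrete_charge c x) D h = \sum_(j < r) c j * h (x j).
Proof.
rewrite /charge_integral; case: cid => -[P N] /= nuPN.
have [[mP _] [mN _] PNT PN0] := nuPN.
have mS : measurable (\bigcup_j [set x j]) by exact: fin_bigcup_measurable.
have posE A : measurable A ->
    jordan_pos nuPN A = (\sum_(j < r) c j * \1_(A `&` P) (x j))%:E.
  move=> mA; rewrite jordan_posE cjordan_posE /crestr0 mem_set//=.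
  exact: discrete_chargeE.
have negE A : measurable A ->
    jordan_neg nuPN A = (- \sum_(j < r) c j * \1_(A `&` N) (x j))%:E.
  move=> mA; rewrite jordan_negE cjordan_negE /crestr0 mem_set//=.
  by rewrite /crestr discrete_chargeE.
have out B (i : 'I_r) : \1_(~` (\bigcup_j [set x j]) `&` B) (x i) = 0 :> R.
  by rewrite indicE memNset// => -[nS _]; apply: nS; exists i.
have mSC := measurableC mS.
transitivity (
    (\sum_(j < r) h (x j) * \sum_(i < r) c i * \1_([set x j] `&` P) (x i)) -
    (\sum_(j < r) h (x j) * - \sum_(i < r) c i * \1_([set x j] `&` N) (x i))).
  congr (_ - _).
    apply: etrans (Rintegral_finite_support (m := jordan_pos nuPN) _) _.
      by apply: etrans (posE _ mSC) _; rewrite big1// => i _; rewrite out mulr0.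
    apply: eq_bigr => j _; congr (_ * _).
    by apply: etrans (congr1 fine (posE _ (mx j))) _.
  apply: etrans (Rintegral_finite_support (m := jordan_neg nuPN) _) _.
    apply: etrans (negE _ mSC) _; rewrite big1 ?oppr0// => i _.
    by rewrite out mulr0.
  apply: eq_bigr => j _; congr (_ * _).
    by apply: etrans (congr1 fine (negE _ (mx j))) _.
rewrite -sumrB; apply: eq_bigr => j _.
rewrite mulrN opprK -mulrDr -big_split /= mulrC; congr (_ * _).
rewrite (bigD1 j)//= big1 ?addr0 => [|i ij]; last first.
  rewrite !indicE !memNset ?mulr0 ?addr0// => -[/= /xinj E _];
  by rewrite E eqxx in ij.
have xx : x j \in [set x j] by rewrite inE.
rewrite -mulrDr !indicE !in_setI xx /=.
have : (P `|` N) (x j) by rewrite PNT.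
have : ~ (P `&` N) (x j) by rewrite PN0.
rewrite /setI /setU /=.
case: (boolP (x j \in P)); case: (boolP (x j \in N));
  rewrite ?inE ?notin_setE /= => a b c1 c2;
  rewrite ?addr0 ?add0r ?mulr1//.
- by exfalso; apply: c1.
- by case: c2.
Qed.

End discrete_charges.

(** * Continuous functions on the torus and their modulus of continuity *)

Section continuous_on_torus.
Variables (R : realType) (d : nat).
Implicit Types (g : 'rV[R]_d -> R) (h : d.-tuple R -> R) (x y : d.-tuple R).

Definition row_of_tuple x : 'rV[R]_d := \row_i tnth x i.

Lemma continuous_rV_dist g : continuous g -> forall (u : 'rV[R]_d) (e : R), 0 < e ->
  exists2 del : R, 0 < del &
    forall v : 'rV[R]_d, (forall i, `|u 0 i - v 0 i| < del) -> `|g u - g v| < e.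
Proof.
move=> cg u e e0; have /cvgrPdist_lt /(_ e e0) := cg u.
move=> /nbhs_ballP[del /= del0 H]; exists del => // v uv; apply: H.
by split => // i j; rewrite ord1; exact: uv.
Qed.

(** Tuples carry the product sigma-algebra, so the open set where [g] exceeds [a] has to be written
    as a countable union of boxes; rational centres and radii [m.+1%:R^-1] suffice. *)
Lemma measurable_continuous_rV g : continuous g ->
  measurable_fun setT (g \o row_of_tuple).
Proof.
move=> cg mT; apply: (measurability _ (RGenOInfty.measurableE R)) => //.
move=> /= _ [_ [a ->] <-]; rewrite setTI.
pose box (qm : d.-tuple rat * nat) : set (d.-tuple R) :=
  [set y | forall i, `|tnth y i - ratr (tnth qm.1 i)| < qm.2.+1%:R^-1].
(* The inclusion does not involve [y], so [F qm] is either the whole box or empty. *)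
pose F qm := [set y | box qm y /\ box qm `<=` (g \o row_of_tuple) @^-1` `]a, +oo[].
have mbox qm : measurable (box qm).
  rewrite (_ : box qm = \bigcap_(i in [set: 'I_d])
      ((fun y : d.-tuple R => `|tnth y i - ratr (tnth qm.1 i)|) @^-1`
         `]-oo, qm.2.+1%:R^-1[)); last first.
    apply/seteqP; split => [y By i _|y By i]; rewrite /= ?in_itv /=; first exact: By.
    by have := By i Logic.I; rewrite /= in_itv.
  apply: fin_bigcap_measurable => // i _; rewrite -[X in measurable X]setTI.
  have : measurable_fun setT (fun y : d.-tuple R => `|tnth y i - ratr (tnth qm.1 i)|).
    apply: measurableT_comp => //; apply: measurable_funB => //.
    exact: measurable_tnth.
  by apply => //; exact: measurable_itv.
rewrite (_ : _ @^-1` _ = \bigcup_qm F qm); last first.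
  apply/seteqP; split => [y|y [qm _ [By]]]; last by apply.
  rewrite /= in_itv /= andbT => ay.
  have [|del del0 Hdel] := @continuous_rV_dist g cg (row_of_tuple y) (g (row_of_tuple y) - a).
    by rewrite subr_gt0.
  (* Half of [del], because two points of one box differ by less than twice its radius in each
     coordinate. *)
  have [m m_del] : exists m : nat, m.+1%:R^-1 < del / 2.
    have del20 : 0 < del / 2 by rewrite divr_gt0.
    have [m _ /(_ m (leqnn m))] := near_infty_natSinv_lt (PosNum del20).
    by exists m.
  have q_ i : exists q : rat, `|tnth y i - ratr q| < m.+1%:R^-1.
    have [|q] := @rat_in_itvoo _ (tnth y i - m.+1%:R^-1) (tnth y i + m.+1%:R^-1).
      by rewrite ltrBlDr -addrA ltrDl addr_gt0// invr_gt0 ltr0n.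
    rewrite in_itv /= => /andP[q1 q2]; exists q.
    rewrite ltr_norml. set c := _.+1%:R^-1 in q1 q2 *.
    by apply/andP; split; lra.
  exists ([tuple projT1 (cid (q_ i)) | i < d], m) => //.
  have By : box ([tuple projT1 (cid (q_ i)) | i < d], m) y.
    by move=> i /=; rewrite tnth_mktuple; case: cid.
  split => // z Bz /=; rewrite in_itv /= andbT.
  have /Hdel : forall i, `|row_of_tuple y 0 i - row_of_tuple z 0 i| < del.
    move=> i; rewrite !mxE.
    have := By i; have := Bz i; rewrite /= => Bzi Byi.
    rewrite (_ : _ - _ = (tnth y i - ratr (tnth [tuple projT1 (cid (q_ i)) | i < d] i))
      - (tnth z i - ratr (tnth [tuple projT1 (cid (q_ i)) | i < d] i))); last by ring.
    apply: le_lt_trans (ler_normB _ _) _.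
    by rewrite [ltRHS]splitr ltrD// (lt_trans _ m_del).
  by move/(le_lt_trans (ler_norm _)); lra.
apply: countable_bigcupT_measurable => [|qm]; first exact: countableP.
have [sub|nsub] := pselect (box qm `<=` (g \o row_of_tuple) @^-1` `]a, +oo[).
  by rewrite (_ : F qm = box qm)//; apply/seteqP; split => [y []|y By].
by rewrite (_ : F qm = set0)//; apply/seteqP; split => // y [].
Qed.

(** Any integer translate lifts [y]; this allows a lift close to a given point even across the
    boundary of the cube. *)
Lemma torus_proj_shift y (m : 'I_d -> int) : torus d y ->
  torus_proj (\row_i (tnth y i + (m i)%:~R)) = y.
Proof.
move=> Ty; apply: eq_from_tnth => i; rewrite tnth_mktuple mxE.
rewrite (@floor_def _ _ (m i)) ?addrK// intrD lerDr [_ + 1]addrC ltrD2r.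
exact: Ty.
Qed.

Lemma torus_proj_row y : torus d y -> torus_proj (row_of_tuple y) = y.
Proof.
move=> /torus_proj_shift - /(_ (fun=> 0)) => {2}<-; congr torus_proj.
by apply/rowP => i; rewrite !mxE addr0.
Qed.

(** Boundedness comes from the compact cube of side [[0, 1]], since the half-open cube of
    representatives is not compact in general. *)
Lemma torus_continuous_tbm h : continuous (h \o @torus_proj R d) ->
  torus_bounded_measurable h.
Proof.
move=> hc; split.
  apply: (eq_measurable_fun ((h \o @torus_proj R d) \o row_of_tuple)).
    by move=> y; rewrite inE => Ty; rewrite /= torus_proj_row.
  by apply: measurable_funTS; exact: measurable_continuous_rV.
have cK : compact [set v : 'rV[R]_d | forall i, `[0, 1]%classic (v ord0 i)].
  by apply: (@rV_compact R d (fun=> `[0, 1]%classic)) => _; exact: segment_compact.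
have cH : {within [set v : 'rV[R]_d | forall i, `[0, 1]%classic (v ord0 i)],
    continuous (h \o @torus_proj R d)} by exact: continuous_subspaceT.
have [M [_ HM]] := compact_bounded (continuous_compact cH cK).
exists (M + 1) => y Ty; apply: (HM (M + 1)); first by rewrite ltrDl.
exists (row_of_tuple y); last by rewrite /= torus_proj_row.
by move=> i; rewrite /= mxE in_itv /=; have /andP[-> /ltW] := Ty i.
Qed.

(** The periodic substitute for the squared distance in Korovkin's argument: on the torus it is
    nonnegative and vanishes only at [x]. *)
Definition torus_gap x y : R :=
  \sum_(i < d) (1 - cos (2 * pi * (tnth y i - tnth x i))).

(** Rounding [s] to the nearest integer brings the angle into [[0, pi]], where the cosine decreases;
    [del <= 2^-1] keeps [2 * pi * del] in the same range. *)
Lemma cos_gap (s del : R) : 0 < del <= 2^-1 ->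
  cos (2 * pi * del) < cos (2 * pi * s) -> exists m : int, `|s + m%:~R| < del.
Proof.
move=> /andP[del0 del2] cs; exists (- Num.floor (s + 2^-1)).
have /andP[] := floor_itv (s + 2^-1); rewrite intrD rmorphN /=.
set m := (Num.floor _)%:~R => fl1 fl2.
have ab : `|s - m| <= 2^-1 by rewrite ler_norml; lra.
have pi0 := pi_gt0 R.
have cE : cos (2 * pi * `|s - m|) = cos (2 * pi * s).
  rewrite -(cosDint (2 * pi * s) (- Num.floor (s + 2^-1))) -mulrDr rmorphN /=.
  by have [_|_] := ger0P (s - m); rewrite ?mulrN ?cosN.
move: cs; rewrite -cE ltr_cos.
- by rewrite ltr_pM2l// mulr_gt0.
- rewrite in_itv /=; apply/andP; split; first by rewrite !mulr_ge0// ltW.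
  by rewrite -[leRHS]mulr1; nra.
- rewrite in_itv /=; apply/andP; split; first by rewrite !mulr_ge0// ltW.
  by nra.
Qed.

(** If every coordinate is close modulo 1, continuity gives [e]; otherwise one term of the gap is at
    least the positive constant [c], and a multiple of the gap absorbs the crude bound [2 * M]. *)
Lemma torus_gap_dominates h x : continuous (h \o @torus_proj R d) -> torus d x ->
  forall e : R, 0 < e -> exists2 C : R, 0 <= C &
    forall y, torus d y -> `|h y - h x| <= e + C * torus_gap x y.
Proof.
move=> hc Tx e e0.
have [_ [M hM]] := torus_continuous_tbm hc.
have M0 : 0 <= M by exact: le_trans (normr_ge0 _) (hM _ Tx).
have [del0 del0_gt0 Hdel] := continuous_rV_dist hc (row_of_tuple x) e0.
pose del := Num.min del0 2^-1.
have del_gt0 : 0 < del by rewrite lt_min del0_gt0 invr_gt0 ltr0n.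
have del_le : del <= 2^-1 by rewrite ge_min lexx orbT.
pose c := 1 - cos (2 * pi * del).
have pi0 := pi_gt0 R.
have c0 : 0 < c.
  rewrite subr_gt0 -[ltRHS]cos0 ltr_cos ?mulr_gt0//.
    by rewrite in_itv /= lexx ltW.
  rewrite in_itv /=; apply/andP; split; first by rewrite !mulr_ge0// ltW.
  by nra.
have gap_ge0 i y : 0 <= 1 - cos (2 * pi * (tnth y i - tnth x i)).
  by rewrite subr_ge0 cos_le1.
exists (2 * M / c); first by rewrite divr_ge0 ?mulr_ge0// ltW.
move=> y Ty; have [close|far] := pselect (forall i,
    cos (2 * pi * del) < cos (2 * pi * (tnth y i - tnth x i))).
  have m_ i : exists m : int, `|tnth y i - tnth x i + m%:~R| < del.
    by apply: cos_gap (close i); rewrite del_gt0.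
  pose m i := projT1 (cid (m_ i)).
  have /Hdel : forall i,
      `|row_of_tuple x 0 i - (\row_i (tnth y i + (m i)%:~R) : 'rV[R]_d) 0 i| < del0.
    move=> i; rewrite !mxE distrC addrAC.
    by apply: lt_le_trans (projT2 (cid (m_ i))) _; rewrite ge_min lexx.
  rewrite /= torus_proj_shift// torus_proj_row// distrC => /ltW/le_trans; apply.
  by rewrite lerDl mulr_ge0 ?divr_ge0 ?mulr_ge0 ?(ltW c0)// sumr_ge0.
have {far}[i gi] : exists i, c <= 1 - cos (2 * pi * (tnth y i - tnth x i)).
  apply: contrapT => /forallNP H; apply: far => i.
  by have /negP := H i; rewrite -ltNge /c => H'; lra.
have cgap : c <= torus_gap x y.
  rewrite /torus_gap (bigD1 i)//= (le_trans gi)// lerDl.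
  by rewrite sumr_ge0.
apply: (@le_trans _ _ (2 * M)).
  by rewrite (le_trans (ler_normB _ _))// mulr_natl mulr2n lerD// hM.
rewrite -[leLHS]add0r lerD ?(ltW e0)// mulrAC ler_pdivlMr//.
by rewrite ler_wpM2l ?mulr_ge0.
Qed.

End continuous_on_torus.

(** * Dirichlet and Fejer kernels *)

Section dirichlet_kernels.
Variables (R : realType) (d n : nat).
Implicit Types (x y t : d.-tuple R) (i l : 'I_d).
Local Notation normc := Normc.normc.
Local Notation mi := (@multi_index d n).
Local Notation N := (dimN d n).

Lemma multi_index_inj : injective mi.
Proof.
move=> a b /(congr1 (fun t : d.-tuple int => t : seq int)) /= ab.
apply: (can_inj (cast_ordK (esym (card_index d n)))).
apply: (can_inj enum_valK); apply: val_inj => /=.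
by apply: inj_map ab => j k [] /val_inj.
Qed.

(** Distributivity, after identifying multi-indices with functions on the coordinates. All product
    formulas for the kernels come from it. *)
Lemma sum_prod_multi_index (K : comNzRingType) (F : 'I_d -> int -> K) :
  \sum_(a < N) \prod_l F l (tnth (mi a) l) =
  \prod_l \sum_(k < n.+1) F l (k : nat)%:Z.
Proof.
rewrite bigA_distr_bigA /=.
pose tup (f : {ffun 'I_d -> 'I_n.+1}) := [tuple f l | l < d].
rewrite (reindex (fun f => cast_ord (card_index d n) (enum_rank (tup f)))) /=.
  apply: eq_bigr => f _; apply: eq_bigr => l _.
  by rewrite /multi_index cast_ordK enum_rankK tnth_map tnth_mktuple.
exists (fun a => [ffun l => tnth (enum_val (cast_ord (esym (card_index d n)) a)) l]).
  move=> f _; rewrite cast_ordK enum_rankK; apply/ffunP => l.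
  by rewrite ffunE tnth_mktuple.
move=> a _; apply: (can_inj (cast_ordK (esym (card_index d n)))); rewrite cast_ordK.
rewrite -[RHS]enum_valK; congr enum_rank; apply: eq_from_tnth => l.
by rewrite tnth_mktuple ffunE.
Qed.

Lemma dimN_gt0 : 0 < N%:R :> R.
Proof. by rewrite ltr0n expn_gt0. Qed.

(** The count is that of a face of the index cube, the power [d - 1] of [n.+1]; the quotient form
    displays the gain of a factor [n.+1] over [N]. *)
Lemma card_multi_index_eq0 i :
  \sum_(a < N) (tnth (mi a) i == 0)%:R = N%:R / n.+1%:R :> R.
Proof.
pose F l (k : int) : R := if l == i then (k == 0)%:R else 1.
rewrite (eq_bigr (fun a : 'I_N => \prod_l F l (tnth (mi a) l))); last first.
  move=> a _; rewrite (bigD1 i)//= /F eqxx big1 ?mulr1// => l li.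
  by rewrite (negbTE li).
rewrite sum_prod_multi_index (bigD1 i)//= /F eqxx big_ord_recl big1 => [|k _ //].
rewrite addr0 mul1r (eq_bigr (fun=> n.+1%:R)); last first.
  by move=> l li; rewrite (negbTE li) sumr_const card_ord.
rewrite prodr_const cardC1 card_ord /dimN.
rewrite -[X in _ = (_ ^ X)%:R / _](ltn_predK (ltn_ord i)).
by rewrite expnS natrM mulrAC divff ?pnatr_eq0// mul1r natrX.
Qed.

Definition tuple_sub x y : d.-tuple R := [tuple tnth x i - tnth y i | i < d].

Definition dirichlet t : R[i] := trigsum mi (fun=> 1) t.

(** What is left of [dirichlet] once its geometric sum in the variable [i] is removed, written as a
    trigonometric sum so that Parseval applies. *)
Definition dirichlet_face i t : R[i] :=
  trigsum mi (fun a => (tnth (mi a) i == 0)%:R) t.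

Lemma expi_dotkx (k : d.-tuple int) t :
  expi (2 * pi * dotkx k t) = \prod_l expi (2 * pi * tnth t l * (tnth k l)%:~R).
Proof.
rewrite /dotkx mulr_sumr expi_sum; apply: eq_bigr => l _.
by congr expi; ring.
Qed.

Lemma dirichletE t :
  dirichlet t = \prod_l \sum_(k < n.+1) expi (2 * pi * tnth t l) ^+ k.
Proof.
rewrite /dirichlet /trigsum.
pose F l (k : int) := expi (2 * pi * tnth t l * k%:~R).
rewrite (eq_bigr (fun a : 'I_N => \prod_l F l (tnth (mi a) l))); last first.
  by move=> a _; rewrite mul1r expi_dotkx.
rewrite sum_prod_multi_index; apply: eq_bigr => l _; apply: eq_bigr => k _.
by rewrite /F expiMn.
Qed.

Lemma dirichlet_faceE i t :
  dirichlet_face i t =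
  \prod_(l | l != i) \sum_(k < n.+1) expi (2 * pi * tnth t l) ^+ k.
Proof.
rewrite /dirichlet_face /trigsum.
pose F l (k : int) : R[i] := (if l == i then (k == 0)%:R else 1) *
  expi (2 * pi * tnth t l * k%:~R).
rewrite (eq_bigr (fun a : 'I_N => \prod_l F l (tnth (mi a) l))); last first.
  move=> a _; rewrite expi_dotkx big_split /=; congr (_ * _).
  rewrite (bigD1 i)//= eqxx big1 ?mulr1// => l li.
  by rewrite (negbTE li).
rewrite sum_prod_multi_index (bigD1 i)//= /F eqxx big_ord_recl big1 => [|k _].
  rewrite mulr0 expi0 mulr1 addr0 mul1r; apply: eq_bigr => l li.
  apply: eq_bigr => k _; by rewrite (negbTE li) mul1r expiMn.
by rewrite mul0r.
Qed.

(* Multiplying a geometric sum in the [i]-th variable by [1 - z] telescopes it. *)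
Lemma le_dirichlet i t :
  normc (1 - expi (2 * pi * tnth t i)) * normc (dirichlet t) <=
  2 * normc (dirichlet_face i t).
Proof.
rewrite dirichletE dirichlet_faceE (bigD1 i)// Normc.normcM mulrA -Normc.normcM.
rewrite ler_wpM2r ?normc_ge0//.
set z := expi _; rewrite (_ : (1 - z) * _ = 1 - z ^+ n.+1); last first.
  by rewrite -[1 - z]opprB mulNr -subrX1 opprB.
apply: le_trans (le_normcD _ _) _; rewrite normcN Normc.normc1.
by rewrite /z -expiMn normc_expi.
Qed.

Lemma normc2_1Bexpi (a : R) : normc (1 - expi a) ^+ 2 = 2 * (1 - cos a).
Proof.
rewrite normc2E /= sub0r sqrrN; have := cos2Dsin2 a.
by move=> h; rewrite sqrrB expr1n mul1r -addrA h mulr2n; ring.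
Qed.

Lemma normc_dirichlet_face i t : normc (dirichlet_face i t) <= N%:R / n.+1%:R.
Proof.
rewrite -(card_multi_index_eq0 i) (le_trans (normc_sum _ _ _))//.
apply: ler_sum => a _; rewrite Normc.normcM normc_expi mulr1.
by case: eqP; rewrite ?Normc.normc1 ?Normc.normc0.
Qed.

Definition fejer x y : R := N%:R^-1 * normc (dirichlet (tuple_sub y x)) ^+ 2.

Lemma expi_tuple_sub (k : d.-tuple int) x y :
  expi (2 * pi * dotkx k (tuple_sub y x)) =
  expi (- (2 * pi * dotkx k x)) * expi (2 * pi * dotkx k y).
Proof.
rewrite -expiD; congr expi; rewrite addrC -mulrBr /dotkx -sumrB; congr (_ * _).
by apply: eq_bigr => l _; rewrite tnth_mktuple mulrBr.
Qed.

(** The translation by [x] passes into coefficients of modulus one, which gives a trigonometric sum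
    in [y]. *)
Lemma dirichlet_shift x y :
  dirichlet (tuple_sub y x) =
  trigsum mi (fun a => expi (- (2 * pi * dotkx (mi a) x))) y.
Proof. by apply: eq_bigr => a _; rewrite mul1r expi_tuple_sub. Qed.

Lemma dirichlet_face_shift i x y :
  dirichlet_face i (tuple_sub y x) =
  trigsum mi (fun a => (tnth (mi a) i == 0)%:R *
                       expi (- (2 * pi * dotkx (mi a) x))) y.
Proof. by apply: eq_bigr => a _; rewrite expi_tuple_sub mulrA. Qed.

Lemma fejer_ge0 x y : 0 <= fejer x y.
Proof. by rewrite mulr_ge0 ?sqr_ge0// invr_ge0 ler0n. Qed.

Lemma tbm_fejer x : torus_bounded_measurable (fejer x).
Proof.
rewrite /fejer; apply: tbmM; first exact: tbm_cst.
by under eq_fun do rewrite dirichlet_shift; exact: tbm_normc2_trigsum.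
Qed.

(** Parseval sums [N] coefficients of modulus one, and the prefactor is [N%:R^-1]. *)
Lemma torus_integral_fejer x : torus_integral (fejer x) = 1.
Proof.
rewrite /fejer; under [X in torus_integral X]eq_fun do rewrite dirichlet_shift.
rewrite torus_integralZ; last exact: tbm_normc2_trigsum.
rewrite parseval; last exact: multi_index_inj.
under eq_bigr do rewrite normc_expi expr1n.
by rewrite sumr_const card_ord mulVf// gt_eqF// dimN_gt0.
Qed.

Lemma tbm_gap_term x i :
  torus_bounded_measurable (fun y => 1 - cos (2 * pi * (tnth y i - tnth x i))).
Proof.
pose k : d.-tuple int := [tuple (l == i)%:Z | l < d].
have kE y : dotkx k y = tnth y i.
  rewrite /dotkx (bigD1 i)//= tnth_mktuple eqxx mul1r big1 ?addr0// => l li.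
  by rewrite tnth_mktuple (negbTE li) mul0r.
apply: tbmB; first exact: tbm_cst.
rewrite (_ : (fun _ => _) =
  (fun y => cos (2 * pi * dotkx k y + - (2 * pi * tnth x i)))).
  exact: tbm_cos.
by apply/funext => y; rewrite kE mulrBr.
Qed.

Lemma tbm_torus_gap x : torus_bounded_measurable (torus_gap x).
Proof. by apply: tbm_sum => i; exact: tbm_gap_term. Qed.

(** Each coordinate contributes at most [2 / n.+1%:R]: the squared form of [le_dirichlet] replaces
    the kernel by its face, whose square has integral [N%:R / n.+1%:R] by Parseval. *)
Lemma torus_integral_gap_fejer x :
  torus_integral (fun y => torus_gap x y * fejer x y) <= 2 * d%:R / n.+1%:R.
Proof.
under [X in torus_integral X]eq_fun do rewrite /torus_gap mulr_suml.
have tbmi i : torus_bounded_measurable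
    (fun y => (1 - cos (2 * pi * (tnth y i - tnth x i))) * fejer x y).
  by apply: tbmM; [exact: tbm_gap_term|exact: tbm_fejer].
rewrite torus_integral_sum//.
apply: (@le_trans _ _ (\sum_(i < d) 2 / n.+1%:R)); last first.
  by rewrite sumr_const card_ord -[leLHS]mulr_natr mulrAC.
apply: ler_sum => i _.
pose c a := (tnth (mi a) i == 0)%:R * expi (- (2 * pi * dotkx (mi a) x)).
(* The factor 2 is 4 from squaring [le_dirichlet], divided by the 2 in [normc2_1Bexpi]. *)
apply: (@le_trans _ _ (torus_integral (fun y =>
    2 * N%:R^-1 * normc (trigsum mi c y) ^+ 2))).
  apply: le_torus_integral => //.
    by apply: tbmM; [exact: tbm_cst|exact: tbm_normc2_trigsum].
  move=> y _; rewrite /fejer -dirichlet_face_shift.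
  have := le_dirichlet i (tuple_sub y x); rewrite tnth_mktuple.
  rewrite -(@ler_pXn2r _ 2)// ?nnegrE ?mulr_ge0 ?normc_ge0//.
  rewrite !exprMn normc2_1Bexpi => h.
  rewrite mulrCA -[leRHS]mulrA [leRHS]mulrCA ler_pM2l ?invr_gt0 ?dimN_gt0//.
  by lra.
rewrite torus_integralZ; last exact: tbm_normc2_trigsum.
rewrite parseval; last exact: multi_index_inj.
rewrite (eq_bigr (fun a => (tnth (mi a) i == 0)%:R)); last first.
  move=> a _; rewrite Normc.normcM normc_expi mulr1.
  by case: eqP; rewrite ?Normc.normc1 ?Normc.normc0 ?expr1n ?expr0n.
by rewrite card_multi_index_eq0 mulrA divfK// gt_eqF// dimN_gt0.
Qed.

End dirichlet_kernels.

Lemma cos_2pi_lt1 (R : realType) (s : R) : s != 0 -> `|s| < 1 -> cos (2 * pi * s) < 1.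
Proof.
move=> s0 s1.
have -> : cos (2 * pi * s) = cos (2 * pi * `|s|).
  by have [_|_] := ger0P s; rewrite ?mulrN ?cosN.
have -> : 2 * pi * `|s| = (pi * `|s|) *+ 2 by rewrite mulr2n; ring.
have sin0 : 0 < sin (pi * `|s|).
  apply: sin_gt0_pi; rewrite mulr_gt0 ?pi_gt0 ?normr_gt0//=.
  by rewrite -[ltRHS]mulr1 ltr_pM2l ?pi_gt0.
rewrite cos_mulr2n cos2sin2 mulr2n.
by have := exprn_gt0 2 sin0; lra.
Qed.

(** In a coordinate where the points differ, [1 - z] is nonzero and independent of [n]; the face is
    bounded by its number of terms. *)
Lemma dirichlet_decay (R : realType) d (x y : d.-tuple R) :
  torus d x -> torus d y -> x != y -> exists C : R, forall n,
    (dimN d n)%:R^-1 * Normc.normc (dirichlet n (tuple_sub y x)) <= C / n.+1%:R.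
Proof.
move=> Tx Ty xy.
have [i xyi] : exists i, tnth x i != tnth y i.
  apply/existsP; apply: contraNT xy; rewrite negb_exists => /forallP h.
  by apply/eqP/eq_from_tnth => i; apply/eqP; have := h i; rewrite negbK.
set t := tuple_sub y x.
have c0 : 0 < Normc.normc (1 - expi (2 * pi * tnth t i)).
  rewrite lt_neqAle normc_ge0 andbT eq_sym -sqrf_eq0 normc2_1Bexpi.
  rewrite mulf_neq0 ?pnatr_eq0// subr_eq0 gt_eqF// cos_2pi_lt1//.
    by rewrite tnth_mktuple subr_eq0 eq_sym.
  have /andP[x0 x1] := Tx i; have /andP[y0 y1] := Ty i.
  by rewrite tnth_mktuple ltr_norml; apply/andP; split; lra.
exists (2 / Normc.normc (1 - expi (2 * pi * tnth t i))) => n.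
have h : Normc.normc (1 - expi (2 * pi * tnth t i)) * Normc.normc (dirichlet n t)
    <= 2 * ((dimN d n)%:R / n.+1%:R).
  apply: le_trans (le_dirichlet n i t) _.
  by rewrite ler_pM2l//; exact: normc_dirichlet_face.
rewrite mulrC ler_pdivrMr ?dimN_gt0// mulrAC -mulrA mulrAC ler_pdivlMr//.
by rewrite mulrC (le_trans h)// mulrCA mulrC.
Qed.

(** * Singular vectors and nearly orthogonal families *)

Section singular_vectors.
Variable R : realType.
Local Notation normc := Normc.normc.
Local Notation C := R[i].

Lemma conjCE (z : C) : Num.conj z = z^*%C.
Proof. by []. Qed.

Lemma normr_Re_le (z : C) : `|complex.Re z| <= normc z.
Proof. by rewrite -lecR; exact: normc_ge_Re. Qed.

Lemma normr_Im_le (z : C) : `|complex.Im z| <= normc z.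
Proof.
by case: z => a b /=; rewrite -sqrtr_sqr ler_sqrt ?addr_ge0 ?sqr_ge0// lerDr sqr_ge0.
Qed.

Definition normc2_row m (z : 'rV[C]_m) : R := \sum_k normc (z 0 k) ^+ 2.

Lemma normc2_row_ge0 m (z : 'rV[C]_m) : 0 <= normc2_row z.
Proof. by apply: sumr_ge0 => k _; exact: sqr_ge0. Qed.

Lemma normc2_rowE m (z : 'rV[C]_m) : (normc2_row z)%:C = (z *m z^t*) 0 0.
Proof.
rewrite /normc2_row rmorph_sum mxE; apply: eq_bigr => k _ /=.
by rewrite !mxE normc2_conj.
Qed.

Lemma normc2_row_eq0 m (z : 'rV[C]_m) : normc2_row z = 0 -> z = 0.
Proof.
move=> /eqP; rewrite psumr_eq0 => [/allP z0|k _]; last exact: sqr_ge0.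
apply/rowP => k; rewrite mxE; apply: (@Normc.eq0_normc R).
by have := z0 k (mem_index_enum _); rewrite sqrf_eq0 => /eqP.
Qed.

(** Off the diagonal, a product of two moduli is at most the mean of their squares; summing this
    over all pairs gives the factor [r]. *)
Lemma quadratic_form_near_scalar r (G : 'M[C]_r) (z : 'rV[C]_r) (N c : R) :
  0 <= c -> (forall k, G k k = N%:C) ->
  (forall k l, k != l -> normc (G k l) <= c) ->
  `|complex.Re ((z *m G *m z^t*) 0 0) - N * normc2_row z| <=
  c * r%:R * normc2_row z.
Proof.
move=> c0 Gd Go.
have -> : complex.Re ((z *m G *m z^t*) 0 0) - N * normc2_row z =
    \sum_l \sum_(k | k != l) complex.Re (z 0 k * G k l * (z 0 l)^*%C).
  rewrite mxE Re_sum mulr_sumr -sumrB; apply: eq_bigr => l _.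
  rewrite !mxE mulr_suml Re_sum (bigD1 l)//= Gd mulrAC -normc2_conj.
  by rewrite -rmorphM /= [N * _]mulrC addrAC subrr add0r.
rewrite (le_trans (ler_norm_sum _ _ _))//.
apply: (@le_trans _ _ (\sum_(l < r) \sum_(k < r)
    c * ((normc (z 0 k) ^+ 2 + normc (z 0 l) ^+ 2) / 2))).
  apply: ler_sum => l _; rewrite (le_trans (ler_norm_sum _ _ _))//.
  rewrite [leRHS](bigD1 l)//= -[leLHS]add0r lerD//.
    by rewrite mulr_ge0// divr_ge0// addr_ge0// sqr_ge0.
  apply: ler_sum => k kl; rewrite (le_trans (normr_Re_le _))//.
  rewrite !Normc.normcM normc_conjc mulrAC mulrC ler_pM ?mulr_ge0 ?normc_ge0//.
    exact: Go.
  by have := sqr_ge0 (normc (z 0 k) - normc (z 0 l)); rewrite sqrrB; lra.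
under eq_bigr do rewrite -mulr_sumr -mulr_suml big_split /= sumr_const card_ord.
rewrite -mulr_sumr -mulr_suml big_split /= sumr_const card_ord sumrMnl.
by rewrite -mulrA ler_wpM2l// -mulr2n -[_ *+ 2]mulr_natr mulfK ?pnatr_eq0// mulr_natl.
Qed.

(** By monotonicity, [s j != 0] makes the first [j.+1] singular values positive, which forces the
    rank above [j]. *)
Lemma svd_rank_eq0 (N : nat) (A U V : 'M[C]_N) (s : 'I_N -> R) :
  is_svd A U V s -> forall j : 'I_N, (\rank A <= j)%N -> s j = 0.
Proof.
move=> [Uu Vu s0 smono AE] j; apply: contraTeq => sj0.
pose D : 'M[C]_N := diag_mx (\row_j (s j)%:C).
have Vfree : row_free (V^t*).
  by rewrite row_free_unit; apply: unitarymx_unit; rewrite trmxC_unitary.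
have Ufull : row_full U by rewrite row_full_unit; exact: unitarymx_unit.
have -> : \rank A = \rank D by rewrite AE mxrankMfree// eqmxMfull.
rewrite -ltnNge.
(* Inverting only the first [j.+1] diagonal entries makes the product a partial identity of known
   rank. *)
pose D' : 'M[C]_N := diag_mx (\row_i (if (i <= j)%N then ((s i)%:C)^-1 else 0)).
have D'D : D' *m D = pid_mx j.+1.
  rewrite mul_diag_mx; apply/matrixP => a b; rewrite !mxE ltnS.
  case: (leqP a j) => aj; last by rewrite mul0r andbF.
  have sa0 : (s a)%:C != 0 :> C.
    rewrite fmorph_eq0 gt_eqF// (lt_le_trans _ (smono _ _ aj))//.
    by rewrite lt_neqAle eq_sym sj0 s0.
  have [<-|ab] := eqVneq a b; first by rewrite eqxx mulr1n mulVf.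
  by rewrite val_eqE (negbTE ab) mulr0n mulr0.
by rewrite -[j.+1](@rank_pid_mx C N N) -?D'D ?mxrankM_maxr.
Qed.

(** Row [j] of [U^t*] times the matrix vanishes beyond the rank, and the row-free factor
    [diag_mx l *m E^t*] cancels on the right. Thus the trailing left singular vectors are orthogonal
    to the columns of [E]. *)
Lemma svd_rank_factor (N r : nat) (E : 'M[C]_(N, r)) (l : 'rV[C]_r)
    (U V : 'M[C]_N) (s : 'I_N -> R) :
  row_free (E^t*) -> (forall j, l 0 j != 0) ->
  is_svd (E *m diag_mx l *m E^t*) U V s ->
  \rank (E *m diag_mx l *m E^t*) = r /\
  forall (j : 'I_N) k, (r <= j)%N -> (U^t* *m E) j k = 0.
Proof.
move=> Efree l0 svd.
have lE : row_free (diag_mx l *m E^t*).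
  rewrite /row_free mxrankMfree//; apply/eqP/mxrank_unit.
  by rewrite unitmxE det_diag unitfE; apply/prodf_neq0 => j _; exact: l0.
have rk : \rank (E *m diag_mx l *m E^t*) = r.
  rewrite -mulmxA mxrankMfree// -mxrank_tr -(mxrank_map Num.conj).
  by move/eqP: Efree.
split => // j k rj.
have sj0 : s j = 0 by apply: (svd_rank_eq0 svd); rewrite rk.
have [Uu _ _ _ AE] := svd.
have : row j (U^t* *m E) *m (diag_mx l *m E^t*) = 0.
  have UA : U^t* *m (E *m diag_mx l *m E^t*) = diag_mx (\row_j (s j)%:C) *m V^t*.
    by rewrite AE !mulmxA (mulmx1C (unitarymxP Uu)) mul1mx.
  have -> : row j (U^t* *m E) *m (diag_mx l *m E^t*) =
      row j (U^t* *m (E *m diag_mx l *m E^t*)) by rewrite -row_mul !mulmxA.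
  rewrite UA row_mul.
  rewrite (_ : row j (diag_mx _) = 0) ?mul0mx//.
  by apply/rowP => k'; rewrite !mxE sj0 mul0rn.
move=> /eqP; rewrite mulmx_free_eq0// => /eqP /rowP /(_ k).
by rewrite !mxE.
Qed.

(* With [z = w B], expand [0 <= |w - t z B^*|^2] on the first [r] coordinates. *)
Lemma normc2_rowM_le (N r : nat) (B : 'M[C]_(N, r)) (w : 'rV[C]_N) (M c : R) :
  0 <= c -> 0 < M ->
  (forall (j : 'I_N) k, (r <= j)%N -> B j k = 0) ->
  (forall k, (B^t* *m B) k k = M%:C) ->
  (forall k l, k != l -> normc ((B^t* *m B) k l) <= c) ->
  normc2_row (w *m B) <=
  (M + c * r%:R) * \sum_(j < N | (j < r)%N) normc (w 0 j) ^+ 2.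
Proof.
move=> c0 M0 B0 Gd Go; set z := w *m B; set S := normc2_row z.
pose v := z *m B^t*.
have Mc0 : 0 < M + c * r%:R by rewrite ltr_wpDr// mulr_ge0.
have vE : v^t* = B *m z^t*.
  by rewrite /v trmx_mul map_mxM /= trmxCK.
have v0 (j : 'I_N) : (r <= j)%N -> v 0 j = 0.
  move=> rj; rewrite mxE big1// => k _; rewrite !mxE B0//.
  by rewrite conjCE conjc0 mulr0.
have vtE j : (v^t*) j 0 = (v 0 j)^*%C by rewrite mxE mxE.
(* Since [v] vanishes from coordinate [r] on, truncating [w] does not change the pairing. *)
have vw : \sum_(j < N | (j < r)%N) complex.Re (w 0 j * (v 0 j)^*%C) = S.
  transitivity (complex.Re ((w *m v^t*) 0 0)); last first.
    by rewrite vE mulmxA -normc2_rowE.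
  rewrite mxE Re_sum [RHS](bigID (fun j : 'I_N => (j < r)%N)) /=.
  rewrite [X in _ + X]big1 ?addr0 => [|j]; last first.
    by rewrite -leqNgt => /v0 vj0; rewrite vtE vj0 conjc0 mulr0.
  by apply: eq_bigr => j _; rewrite vtE.
have vv : \sum_(j < N | (j < r)%N) normc (v 0 j) ^+ 2 <= (M + c * r%:R) * S.
  apply: (@le_trans _ _ (normc2_row v)).
    rewrite /normc2_row [leRHS](bigID (fun j : 'I_N => (j < r)%N)) /= lerDl.
    by apply: sumr_ge0 => j _; exact: sqr_ge0.
  have := quadratic_form_near_scalar z c0 Gd Go.
  rewrite mulmxA -mulmxA -vE -normc2_rowE /= -/S => /ler_normlP[_]; lra.
(* With [W] the truncated squared norm of [w], this value minimises
   [W - 2 t S + t^2 (M + c r) S]. *)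
pose t := (M + c * r%:R)^-1.
have : 0 <= \sum_(j < N | (j < r)%N) normc (w 0 j - t%:C * v 0 j) ^+ 2.
  by apply: sumr_ge0 => j _; exact: sqr_ge0.
have -> : \sum_(j < N | (j < r)%N) normc (w 0 j - t%:C * v 0 j) ^+ 2 =
    \sum_(j < N | (j < r)%N) normc (w 0 j) ^+ 2
    - 2 * t * \sum_(j < N | (j < r)%N) complex.Re (w 0 j * (v 0 j)^*%C)
    + t ^+ 2 * \sum_(j < N | (j < r)%N) normc (v 0 j) ^+ 2.
  rewrite !mulr_sumr -sumrB -big_split /=; apply: eq_bigr => j _.
  case: (w 0 j) => a b; case: (v 0 j) => a' b'; rewrite !normc2E /=; ring.
rewrite vw => h.
have t2 : t ^+ 2 * \sum_(j < N | (j < r)%N) normc (v 0 j) ^+ 2 <= t * S.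
  apply: le_trans (ler_wpM2l (sqr_ge0 t) vv) _.
  have tM : t * (M + c * r%:R) = 1 by rewrite mulVf// gt_eqF.
  by rewrite mulrA expr2 -(mulrA t) tM mulr1.
rewrite mulrC -ler_pdivrMr// mulrC -/t; lra.
Qed.

(** The Gram form is at least [M - c * r%:R] times the squared norm, hence has no nonzero null
    vector. *)
Lemma near_orthogonal_row_free (N r : nat) (E : 'M[C]_(N, r)) (M c : R) :
  0 <= c -> c * r%:R < M ->
  (forall k, (E^t* *m E) k k = M%:C) ->
  (forall k l, k != l -> normc ((E^t* *m E) k l) <= c) ->
  row_free (E^t*).
Proof.
move=> c0 cM Gd Go; apply: inj_row_free => v v0.
apply: normc2_row_eq0.
have := quadratic_form_near_scalar v c0 Gd Go.
rewrite mulmxA v0 mul0mx mul0mx mxE /= sub0r normrN ger0_norm; last first.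
  rewrite mulr_ge0 ?normc2_row_ge0// (le_trans _ (ltW cM))// mulr_ge0//.
rewrite -subr_ge0 -mulrBl => h; apply/eqP; rewrite eq_le normc2_row_ge0 andbT.
by rewrite -(@nmulr_rge0 _ (c * r%:R - M))// subr_lt0.
Qed.

End singular_vectors.

(** * Moment matrices of discrete measures and the density of the leading singular vectors *)

Section discrete_moments.
Variables (R : realType) (d r : nat) (x : 'I_r -> d.-tuple R).
Hypotheses (Tx : forall j, torus d (x j)) (xinj : injective x).
Local Notation normc := Normc.normc.

Lemma measurable_tuple_set1 (y : d.-tuple R) : measurable [set y].
Proof.
rewrite (_ : [set y] = \bigcap_(i in [set: 'I_d])
    ((@tnth d R)^~ i @^-1` [set tnth y i])).
  apply: fin_bigcap_measurable => // i _; rewrite -[X in measurable X]setTI.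
  by apply: (@measurable_tnth _ R d i) => //; exact: measurable_set1.
apply/seteqP; split => [z -> //|z zy].
by apply: eq_from_tnth => i; exact: (zy i).
Qed.

Lemma cm_integral_discrete (lam : 'I_r -> R[i]) (f : d.-tuple R -> R[i]) :
  measurable_fun (torus d) (fun y => complex.Re (f y)) ->
  measurable_fun (torus d) (fun y => complex.Im (f y)) ->
  cm_integral (discrete_cmeasure lam x) (torus d) f = \sum_j lam j * f (x j).
Proof.
move=> mRe mIm; rewrite /cm_integral /=.
have mx j : measurable [set x j] by exact: measurable_tuple_set1.
rewrite !(charge_integral_discrete xinj mx (@measurable_torus R d) Tx)//.
rewrite -sumrB -big_split /=; apply/eqP; rewrite eq_complex /= Re_sum Im_sum.
by apply/andP; split; apply/eqP; apply: eq_bigr => j _;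
  case: (lam j) => a b; case: (f (x j)) => a' b'.
Qed.

Lemma moment_discrete (lam : 'I_r -> R[i]) (k : d.-tuple int) :
  moment (discrete_cmeasure lam x) k =
  \sum_j lam j * expi (- (2 * pi * dotkx k (x j))).
Proof.
rewrite /moment cm_integral_discrete//=.
  under eq_fun do rewrite cosN -[2 * pi * _]addr0.
  by case: (tbm_cos k (0 : R)).
under eq_fun do rewrite sinN -cosDpihalf.
by case: (tbm_cos k (pi / 2 : R)).
Qed.

Definition evec_mx n : 'M[R[i]]_(dimN d n, r) := \matrix_(a, j) evec n (x j) a 0.

(** The Vandermonde factorisation: an exponential at a difference of indices splits into a
    product. *)
Lemma moment_matrix_discrete (lam : 'I_r -> R[i]) n :
  moment_matrix (discrete_cmeasure lam x) n =
  evec_mx n *m diag_mx (\row_j lam j) *m (evec_mx n)^t*.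
Proof.
apply/matrixP => a b; rewrite mxE moment_discrete mxE; apply: eq_bigr => j _.
rewrite mul_mx_diag !mxE conjCE -[X in _ = _ * X]expiN.
rewrite [RHS]mulrAC -expiD mulrC; congr (expi _ * _).
by rewrite dotkxB; ring.
Qed.

Lemma gram_dirichlet n k l :
  ((evec_mx n)^t* *m evec_mx n) k l = dirichlet n (tuple_sub (x k) (x l)).
Proof.
rewrite mxE; apply: eq_bigr => a _; rewrite !mxE conjCE.
by rewrite [X in X * _ = _](esym (expiN _)) opprK mul1r expi_tuple_sub mulrC.
Qed.

Lemma evec_mul_trigsum n m (U : 'M[R[i]]_(dimN d n, m)) y j :
  ((evec n y)^t* *m U) 0 j = trigsum (@multi_index d n) (fun a => U a j) y.
Proof.
rewrite mxE; apply: eq_bigr => a _; rewrite !mxE conjCE.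
by rewrite [X in X * _ = _](esym (expiN _)) opprK mulrC.
Qed.

Lemma normc2_row_evec n y :
  normc2_row ((evec n y)^t* *m evec_mx n) =
  (dimN d n)%:R * \sum_j fejer n (x j) y.
Proof.
rewrite mulr_sumr; apply: eq_bigr => j _.
rewrite /fejer mulVKf ?gt_eqF ?dimN_gt0// evec_mul_trigsum dirichlet_shift.
congr (normc _ ^+ 2); apply: eq_bigr => a _.
by rewrite !mxE.
Qed.

Lemma dirichlet0 n (y : d.-tuple R) : dirichlet n (tuple_sub y y) = (dimN d n)%:R%:C.
Proof.
rewrite /dirichlet /trigsum (eq_bigr (fun=> 1)) => [|a _].
  by rewrite sumr_const card_ord rmorph_nat.
rewrite mul1r /dotkx big1 ?mulr0 ?expi0// => i _.
by rewrite tnth_mktuple subrr mulr0.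
Qed.

(** There are finitely many pairs of nodes, so the sum of their constants is uniform. *)
Lemma gram_decay : exists2 K : R, 0 <= K & forall n k l, k != l ->
  normc (dirichlet n (tuple_sub (x k) (x l))) <= (dimN d n)%:R * (K / n.+1%:R).
Proof.
have C_ (kl : 'I_r * 'I_r) : exists2 K : R, 0 <= K & kl.1 != kl.2 ->
    forall n, normc (dirichlet n (tuple_sub (x kl.1) (x kl.2))) <=
      (dimN d n)%:R * (K / n.+1%:R).
  have [e|ne] := eqVneq kl.1 kl.2; first by exists 0.
  have [|K HK] := dirichlet_decay (Tx kl.2) (Tx kl.1).
    by apply: contra ne => /eqP/xinj ->.
  exists `|K| => // _ n; rewrite -ler_pdivrMl ?dimN_gt0//.
  rewrite (le_trans (HK n))// ler_wpM2r ?invr_ge0 ?ler0n//.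
  exact: ler_norm.
pose K kl := projT1 (cid2 (C_ kl)).
have K0 kl : 0 <= K kl by rewrite /K; case: cid2.
exists (\sum_kl K kl); first exact: sumr_ge0.
move=> n k l kl; have := C_ (k, l).
have : normc (dirichlet n (tuple_sub (x k) (x l))) <= (dimN d n)%:R * (K (k, l) / n.+1%:R).
  by rewrite /K; case: cid2 => /= K' _; exact.
move=> h _; apply: le_trans h _.
rewrite ler_pM2l ?dimN_gt0// ler_wpM2r ?invr_ge0 ?ler0n//.
by rewrite (bigD1 (k, l))//= lerDl sumr_ge0.
Qed.

(** The number of terms is fixed at [r], so the density can be studied without reference to the
    rank; once the rank is [r], it equals [dimN d n] times [p1]. *)
Definition leading_density n (U : 'M[R[i]]_(dimN d n)) (y : d.-tuple R) : R :=
  \sum_(j < dimN d n | (j < r)%N) normc (((evec n y)^t* *m U) 0 j) ^+ 2.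

Lemma leading_density_ge0 n (U : 'M[R[i]]_(dimN d n)) y : 0 <= leading_density U y.
Proof. by apply: sumr_ge0 => j _; exact: sqr_ge0. Qed.

Lemma leading_densityE n (U : 'M[R[i]]_(dimN d n)) : leading_density U = fun y =>
  \sum_(j < dimN d n) (j < r)%:R *
    normc (trigsum (@multi_index d n) (fun a => U a j) y) ^+ 2.
Proof.
apply/funext => y; rewrite /leading_density big_mkcond; apply: eq_bigr => j _.
by rewrite evec_mul_trigsum; case: ifP; rewrite ?mul1r ?mul0r.
Qed.

Lemma tbm_leading_density n (U : 'M[R[i]]_(dimN d n)) :
  torus_bounded_measurable (leading_density U).
Proof.
rewrite leading_densityE; apply: tbm_sum => j; apply: tbmM; first exact: tbm_cst.
exact: tbm_normc2_trigsum.
Qed.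

Lemma measurable_leading_density n (U : 'M[R[i]]_(dimN d n)) :
  measurable_fun setT (leading_density U).
Proof.
rewrite leading_densityE; apply: measurable_sum => j; apply: measurable_funM => //.
exact: measurable_normc2_trigsum.
Qed.

(** By Parseval each of the first [r] columns of the unitary matrix [U] contributes 1. *)
Lemma torus_integral_leading_density n (U : 'M[R[i]]_(dimN d n)) :
  (r <= dimN d n)%N -> U \is unitarymx -> torus_integral (leading_density U) = r%:R.
Proof.
move=> rN Uu; rewrite leading_densityE torus_integral_sum => [|j]; last first.
  by apply: tbmM; [exact: tbm_cst|exact: tbm_normc2_trigsum].
rewrite (eq_bigr (fun j : 'I_(dimN d n) => (j < r)%:R)) => [|j _]; last first.
  rewrite torus_integralZ; last exact: tbm_normc2_trigsum.
  rewrite parseval; last exact: multi_index_inj.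
  have /matrixP/(_ j j) := mulmx1C (unitarymxP Uu).
  rewrite !mxE eqxx mulr1n => U1; rewrite (_ : \sum_a _ = 1) ?mulr1//.
  apply: (complexI (R := R)); rewrite rmorph_sum /= rmorph1 -U1.
  by apply: eq_bigr => a _; rewrite !mxE conjCE mulrC -normc2_conj.
rewrite -natr_sum -big_mkcond /= -(big_ord_widen _ (fun=> 1%N) rN).
by rewrite sum1_card card_ord.
Qed.

(** In the basis of the columns of [U], unitarity preserves both the Gram matrix of the nodes and
    their pairings with [evec n y]; [normc2_rowM_le] then applies, and [dimN d n] cancels. *)
Lemma fejer_le_leading_density n (U : 'M[R[i]]_(dimN d n)) (c : R) y :
  0 <= c -> U \is unitarymx ->
  (forall (j : 'I_(dimN d n)) k, (r <= j)%N -> (U^t* *m evec_mx n) j k = 0) ->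
  (forall k l, k != l ->
    normc (dirichlet n (tuple_sub (x k) (x l))) <= (dimN d n)%:R * c) ->
  \sum_j fejer n (x j) y <= (1 + c * r%:R) * leading_density U y.
Proof.
move=> c0 Uu U0 Gc; have N0 := dimN_gt0 R d n.
have UU : U *m U^t* = 1%:M by exact: unitarymxP.
pose B := U^t* *m evec_mx n.
have wB : ((evec n y)^t* *m U) *m B = (evec n y)^t* *m evec_mx n.
  by rewrite /B mulmxA -[_ *m U *m _]mulmxA UU mulmx1.
have BB : B^t* *m B = (evec_mx n)^t* *m evec_mx n.
  by rewrite /B trmx_mul map_mxM /= trmxCK -mulmxA (mulmxA U) UU mul1mx.
have := @normc2_rowM_le R _ r B ((evec n y)^t* *m U) (dimN d n)%:R ((dimN d n)%:R * c).
rewrite wB BB normc2_row_evec -/(leading_density U y) -mulrA -[X in X + _]mulr1.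
rewrite -mulrDr -mulrA ler_pM2l//; apply => //.
- by rewrite mulr_ge0// ltW.
- by move=> k; rewrite gram_dirichlet dirichlet0.
- by move=> k l kl; rewrite gram_dirichlet; exact: Gc.
Qed.

(** The norm integrates over all tuples, but [torus_measure] gives no mass to the complement of the
    torus. *)
Lemma L1norm_torus_integral (q : d.-tuple R -> R) : measurable_fun setT q ->
  (forall y, 0 <= q y) -> L1norm q = torus_integral q.
Proof.
move=> mq q0; rewrite /L1norm Lnorm1 /torus_integral /Rintegral; congr fine.
have mT := @measurable_torus R d.
rewrite (@ge0_negligible_integral _ _ _ _ setT (~` torus d)) //=.
- rewrite setDE setCK setTI; apply: eq_integral => y _.
  by rewrite /= ger0_norm.
- exact: measurableC.
- by apply/measurable_EFinP; exact: measurableT_comp.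
- by rewrite /torus_measure /= /mrestr setICl measure0.
Qed.

End discrete_moments.

(** * Quantitative weak convergence against a real continuous function *)

Section weak_limit.
Variables (R : realType) (d r : nat) (x : 'I_r -> d.-tuple R).
Hypothesis Tx : forall j, torus d (x j).
Variable h : d.-tuple R -> R.
Hypothesis hc : continuous (h \o @torus_proj R d).

Lemma torus_integral_fejer_cvg (e : R) : 0 < e -> exists2 K : R, 0 <= K &
  forall n j, `|torus_integral (fun y => h y * fejer n (x j) y) - h (x j)| <=
              e + K / n.+1%:R.
Proof.
move=> e0; have bh := torus_continuous_tbm hc.
pose C j := projT1 (cid2 (torus_gap_dominates hc (Tx j) e0)).
have C0 j : 0 <= C j by rewrite /C; case: cid2.
have HC j y : torus d y -> `|h y - h (x j)| <= e + C j * torus_gap (x j) y.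
  by rewrite /C; case: cid2 => /= c _; exact.
(* Summing over the nodes makes the constant independent of [j]; [2 * d%:R] is the constant of
   [torus_integral_gap_fejer]. *)
exists (\sum_j C j * (2 * d%:R)).
  by apply: sumr_ge0 => j _; rewrite !mulr_ge0.
move=> n j.
have bF n' := tbm_fejer n' (x j); have bc := @tbm_cst R d.
have bG := tbm_torus_gap (x j).
have -> : torus_integral (fun y => h y * fejer n (x j) y) - h (x j) =
    torus_integral (fun y => (h y - h (x j)) * fejer n (x j) y).
  under [X in _ = torus_integral X]eq_fun do rewrite mulrBl.
  rewrite torus_integralB; [|by apply: tbmM|by apply: tbmM].
  by rewrite torus_integralZ// torus_integral_fejer mulr1.
apply: (@le_trans _ _ (torus_integral (fun y =>
    e * fejer n (x j) y + C j * (torus_gap (x j) y * fejer n (x j) y)))).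
  apply: le_norm_torus_integral.
  - by apply: tbmM => //; apply: tbmB.
  - by apply: tbmD; apply: tbmM => //; apply: tbmM.
  move=> y Ty; rewrite normrM (ger0_norm (fejer_ge0 _ _ _)) mulrA -mulrDl.
  by rewrite ler_wpM2r ?fejer_ge0// HC.
rewrite torus_integralD; [|by apply: tbmM|by do 2 apply: tbmM => //].
rewrite (torus_integralZ e (bF _)) torus_integral_fejer mulr1 lerD2l.
rewrite (torus_integralZ (C j) (tbmM bG (bF _))).
apply: (@le_trans _ _ (C j * (2 * d%:R / n.+1%:R))).
  by rewrite ler_wpM2l// torus_integral_gap_fejer.
rewrite mulrA ler_wpM2r ?invr_ge0 ?ler0n// (bigD1 j)//= lerDl.
by apply: sumr_ge0 => i _; rewrite !mulr_ge0.
Qed.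

(* Only the one-sided bound [sum F_j <= (1 + c) Q] is needed: both sides have
   almost the same mass, so [Q - (1 + c)^-1 sum F_j] is small in [L^1]. *)
Lemma density_estimate (e : R) : 0 < e -> exists2 K : R, 0 <= K &
  forall n (Q : d.-tuple R -> R) (c : R), 0 <= c ->
    torus_bounded_measurable Q -> torus_integral Q = r%:R ->
    (forall y, \sum_j fejer n (x j) y <= (1 + c) * Q y) ->
  `|torus_integral (fun y => h y * Q y) - \sum_j h (x j)| <=
  r%:R * e + K * (c + n.+1%:R^-1).
Proof.
move=> e0; have [K K0 HK] := torus_integral_fejer_cvg e0.
have bh := torus_continuous_tbm hc; have [_ [M hM]] := bh.
have M'0 : 0 <= `|M| by exact: normr_ge0.
have {}hM y : torus d y -> `|h y| <= `|M|.
  by move=> /hM/le_trans; apply; exact: ler_norm.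
(* One [|M|] pays for the remainder [D], the other for replacing [t] by 1 in front of the limit; [K]
   is the rate of the Fejer kernels. *)
exists (r%:R * (2 * `|M| + K)).
  by rewrite mulr_ge0 ?addr_ge0 ?mulr_ge0.
move=> n Q c c0 bQ Q1 FQ.
have c1 : 0 < 1 + c by rewrite ltr_pwDl.
pose t := (1 + c)^-1.
have t0 : 0 < t by rewrite invr_gt0.
have t1 : t <= 1 by rewrite invf_le1// lerDl.
have ct : 1 - t <= c.
  have : t * (1 + c) = 1 by rewrite mulVf// gt_eqF.
  by nra.
have bc := @tbm_cst R d.
have bF j := tbm_fejer n (x j).
pose F y := \sum_j fejer n (x j) y.
have bSF : torus_bounded_measurable F by exact: tbm_sum.
have IF : torus_integral F = r%:R.
  rewrite torus_integral_sum//; under eq_bigr do rewrite torus_integral_fejer.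
  by rewrite sumr_const card_ord.
pose D y := Q y - t * F y.
have bD : torus_bounded_measurable D by apply: tbmB => //; apply: tbmM.
(* By nonnegativity, the integral of [D] is its full mass in absolute value. *)
have D0 y : 0 <= D y.
  by rewrite subr_ge0 mulrC ler_pdivrMr// mulrC; exact: FQ.
have ID : torus_integral D = r%:R * (1 - t).
  rewrite torus_integralB//; last by apply: tbmM.
  by rewrite torus_integralZ// Q1 IF; ring.
have hQ : torus_integral (fun y => h y * Q y) =
    torus_integral (fun y => h y * D y) +
    t * \sum_j torus_integral (fun y => h y * fejer n (x j) y).
  rewrite -torus_integral_sum => [|j]; last exact: tbmM.
  rewrite -torus_integralZ; last by apply: tbm_sum => j; exact: tbmM.
  rewrite -torus_integralD; last 2 first.
  - exact: tbmM.
  - by apply: tbmM => //; apply: tbm_sum => j; exact: tbmM.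
  congr torus_integral; apply/funext => y.
  by rewrite -mulr_sumr -/(F y) /D; ring.
have hD : `|torus_integral (fun y => h y * D y)| <= r%:R * `|M| * (1 - t).
  apply: (@le_trans _ _ (torus_integral (fun y => `|M| * D y))).
    apply: le_norm_torus_integral; [exact: tbmM|exact: tbmM|move=> y Ty].
    by rewrite normrM (ger0_norm (D0 y)) ler_wpM2r// hM.
  by rewrite torus_integralZ// ID mulrCA mulrA.
have hF : `|\sum_j torus_integral (fun y => h y * fejer n (x j) y)
             - \sum_j h (x j)| <= r%:R * (e + K / n.+1%:R).
  rewrite -sumrB (le_trans (ler_norm_sum _ _ _))//.
  by rewrite (le_trans (ler_sum _ (fun j _ => HK n j)))// sumr_const card_ord mulr_natl.
have hS : `|\sum_j h (x j)| <= r%:R * `|M|.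
  rewrite (le_trans (ler_norm_sum _ _ _))//.
  by rewrite (le_trans (ler_sum _ (fun j _ => hM _ (Tx j))))// sumr_const card_ord mulr_natl.
rewrite hQ; set A := torus_integral _ in hD *.
set B := (\sum_j torus_integral _) in hF *.
set S := (\sum_j h (x j)) in hF hS *.
rewrite (_ : _ - S = A + t * (B - S) - (1 - t) * S); last by ring.
have t1' : 0 <= 1 - t by rewrite subr_ge0.
apply: (@le_trans _ _ (r%:R * `|M| * (1 - t) + r%:R * (e + K / n.+1%:R)
   + (1 - t) * (r%:R * `|M|))).
  rewrite (le_trans (ler_normB _ _))// lerD//.
    rewrite (le_trans (ler_normD _ _))// lerD//.
    rewrite normrM (ger0_norm (ltW t0)) (le_trans _ hF)//.
    by rewrite ler_piMl.
  by rewrite normrM (ger0_norm t1') ler_wpM2l.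
have r0 : 0 <= r%:R :> R by [].
have i0 : 0 <= n.+1%:R^-1 :> R by rewrite invr_ge0.
have rM0 : 0 <= r%:R * `|M| by rewrite mulr_ge0.
have h1 : r%:R * `|M| * (1 - t) <= r%:R * `|M| * c by rewrite ler_wpM2l.
have h2 : 0 <= r%:R * K * c by rewrite !mulr_ge0.
have h3 : 0 <= r%:R * `|M| * n.+1%:R^-1 by rewrite !mulr_ge0.
rewrite [(1 - t) * _]mulrC.
rewrite (_ : r%:R * e + _ = r%:R * (e + K / n.+1%:R) +
  2 * (r%:R * `|M| * c) + r%:R * K * c + 2 * (r%:R * `|M| * n.+1%:R^-1)); last by ring.
have lin (a b b' a' g : R) : a <= b -> 0 <= b' -> 0 <= a' ->
    a + g + a <= g + 2 * b + b' + 2 * a' by lra.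
exact: lin.
Qed.

End weak_limit.

(** * Complex-valued limits and the normalised density *)

Lemma cvg_complex (R : realType) (u : nat -> R[i]) (l : R[i]) :
  (forall e : R, 0 < e -> \forall n \near \oo,
     `|complex.Re (u n) - complex.Re l| < e /\
     `|complex.Im (u n) - complex.Im l| < e) ->
  (u : nat -> R[i]^o) @ \oo --> (l : R[i]^o).
Proof.
(* The tolerance is a positive element of [R[i]], so its imaginary part is 0. *)
move=> H; apply/cvgrPdist_lt => -[e e']; rewrite ltcE /= => /andP[/eqP -> e0].
have /H : 0 < e / 2 by rewrite divr_gt0.
apply: filterS => n [hR hI].
have : Normc.normc (l - u n) < e.
  have -> : l - u n = (complex.Re l - complex.Re (u n))%:C +
     (0 +i* (complex.Im l - complex.Im (u n))).
    case: l (u n) {H hR hI} => a b [a' b']; apply/eqP.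
    by rewrite eq_complex /= addr0 add0r !eqxx.
  apply: le_lt_trans (le_normcD _ _) _.
  rewrite /= !expr0n /= addr0 add0r !sqrtr_sqr.
  by rewrite [ltRHS]splitr ltrD// distrC.
by move=> he; rewrite -ltcR in he.
Qed.

Lemma torus_continuous_ReIm (R : realType) d (f : d.-tuple R -> R[i]^o) :
  torus_continuous f ->
  continuous ((fun y => complex.Re (f y)) \o @torus_proj R d) /\
  continuous ((fun y => complex.Im (f y)) \o @torus_proj R d).
Proof.
move=> cf.
have near_f (v : 'rV[R]_d) (e : R) : 0 < e -> \forall w \near v,
    Normc.normc (f (torus_proj v) - f (torus_proj w)) < e.
  move=> e0; have /(@cvgrPdist_lt _ _ _ _ (nbhs_filter v))/(_ e%:C) := cf v.
  by rewrite ltcR => /(_ e0); apply: filterS => w; rewrite /= -ltcR.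
split => v; apply/(@cvgrPdist_lt _ _ _ _ (nbhs_filter v)) => e /(near_f v); apply: filterS => w;
    apply: le_lt_trans.
  apply: le_trans (normr_Re_le _).
  by rewrite /=; case: (f (torus_proj v)) (f (torus_proj w)) => a b [a' b'].
apply: le_trans (normr_Im_le _).
by rewrite /=; case: (f (torus_proj v)) (f (torus_proj w)) => a b [a' b'].
Qed.

Lemma near_inv_lt (R : realType) (A e : R) : 0 <= A -> 0 < e ->
  \forall n \near \oo, A / n.+1%:R < e.
Proof.
move=> A0 e0; have eA : 0 < e / (A + 1) by rewrite divr_gt0// ltr_wpDl.
apply: filterS (near_infty_natSinv_lt (PosNum eA)) => n /=.
rewrite ltr_pdivlMr ?ltr_wpDl// => h; apply: le_lt_trans h.
by rewrite mulrC ler_wpM2l ?invr_ge0// lerDl.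
Qed.

Lemma density_cvg (R : realType) (d r : nat) (x : 'I_r -> d.-tuple R)
    (Q : nat -> d.-tuple R -> R) (K : R) (h : d.-tuple R -> R) :
  (0 < r)%N -> 0 <= K -> (forall j, torus d (x j)) ->
  (\forall n \near \oo, [/\ torus_bounded_measurable (Q n),
     torus_integral (Q n) = r%:R &
     forall y, \sum_j fejer n (x j) y <= (1 + K / n.+1%:R) * Q n y]) ->
  continuous (h \o @torus_proj R d) ->
  forall e : R, 0 < e -> \forall n \near \oo,
    `|torus_integral (fun y => h y * (Q n y / r%:R))
      - \sum_j r%:R^-1 * h (x j)| < e.
Proof.
move=> r0 K0 Tx HQ hc e e0.
have r0' : 0 < r%:R :> R by rewrite ltr0n.
have [|L L0 HL] := @density_estimate R d r x Tx h hc (e / 2); first by rewrite divr_gt0.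
(* With [c = K / n.+1%:R] the error [L * (c + n.+1%:R^-1)] is [L * (K + 1) / n.+1%:R]; the factor
   [r%:R^-1] comes from the normalisation. *)
have A0 : 0 <= r%:R^-1 * L * (K + 1) by rewrite !mulr_ge0 ?invr_ge0 ?addr_ge0// ltW.
have e20 : 0 < e / 2 by rewrite divr_gt0.
apply: filterS2 HQ (near_inv_lt A0 e20) => n [bQ Q1 QF] hn.
have bhQ : torus_bounded_measurable (fun y => h y * Q n y).
  by apply: tbmM => //; exact: torus_continuous_tbm.
have -> : torus_integral (fun y => h y * (Q n y / r%:R)) =
    r%:R^-1 * torus_integral (fun y => h y * Q n y).
  rewrite -torus_integralZ//; congr torus_integral; apply/funext => y.
  by rewrite mulrA mulrC.
rewrite -mulr_sumr -mulrBr normrM ger0_norm ?invr_ge0 ?ltW//.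
have := HL n (Q n) (K / n.+1%:R) (divr_ge0 K0 (ler0n _ _)) bQ Q1 QF.
rewrite -(@ler_pM2l _ r%:R^-1) ?invr_gt0// => /le_lt_trans; apply.
rewrite mulrDr mulKf ?gt_eqF// [ltRHS]splitr ltrD2l.
apply: le_lt_trans hn.
by rewrite -[X in _ + X]mul1r -mulrDl !mulrA.
Qed.

(** The factor [1 / dimN d n] occurs in both [p1] and its norm and cancels, leaving the mass [r] of
    the leading density. *)
Lemma p1_normalized (R : realType) (d r n : nat) (mu : cmeasure (d.-tuple R) R)
    (U : 'M[R[i]]_(dimN d n)) :
  (r <= dimN d n)%N -> U \is unitarymx -> \rank (moment_matrix mu n) = r ->
  (fun y => p1 mu U y / L1norm (p1 mu U)) =
  (fun y => leading_density r U y / r%:R).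
Proof.
move=> rN Uu rk; have N0 := dimN_gt0 R d n.
have pE : p1 mu U = fun y => (dimN d n)%:R^-1 * leading_density r U y.
  by apply/funext => y; rewrite /p1 rk.
have bD := tbm_leading_density r U.
have -> : L1norm (p1 mu U) = (dimN d n)%:R^-1 * r%:R.
  rewrite L1norm_torus_integral.
  - by rewrite pE torus_integralZ// torus_integral_leading_density.
  - rewrite pE; apply: measurable_funM => //.
    exact: measurable_leading_density.
  - by move=> y; rewrite pE mulr_ge0 ?invr_ge0 ?leading_density_ge0.
apply/funext => y; rewrite pE invfM invrK mulrACA mulVf ?mul1r ?gt_eqF//.
Qed.

Theorem theorem3p7 (R : realType) (d r : nat)
    (x : 'I_r -> d.-tuple R) (lam : 'I_r -> R[i])
    (U V : forall n : nat, 'M[R[i]]_(dimN d n))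
    (s : forall n : nat, 'I_(dimN d n) -> R) :
  let mu := discrete_cmeasure lam x in
  (0 < d)%N ->
  (forall j, torus d (x j)) ->
  injective x ->
  (forall j, lam j != 0) ->
  normalized mu ->
  (forall n, is_svd (moment_matrix mu n) (U n) (V n) (s n)) ->
  weak_cvg (fun n y => p1 mu (U n) y / L1norm (p1 mu (U n)))
           (discrete_cmeasure (fun _ : 'I_r => (r%:R^-1 : R)%:C) x).
Proof.
move=> mu _ Tx xinj lam0 mu1 svd f cf.
(* An empty sum of Dirac masses has total mass 0, contrary to [normalized mu]. *)
have r0 : (0 < r)%N.
  case: (posnP r) mu1 => // r_0; rewrite /normalized discrete_cmeasureE big1.
    by move/eqP; rewrite eq_sym oner_eq0.
  by move=> j _; have := ltn_ord j; rewrite [X in (_ < X)%N]r_0.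
have [cRe cIm] := torus_continuous_ReIm cf.
have [mRe _] := torus_continuous_tbm cRe.
have [mIm _] := torus_continuous_tbm cIm.
rewrite cm_integral_discrete//.
have [K K0 HK] := gram_decay Tx xinj.
have good : \forall n \near \oo,
    [/\ torus_bounded_measurable (leading_density r (U n)),
     torus_integral (leading_density r (U n)) = r%:R,
     forall y, \sum_j fejer n (x j) y <=
       (1 + K * r%:R / n.+1%:R) * leading_density r (U n) y &
     (fun y => p1 mu (U n) y / L1norm (p1 mu (U n))) =
     (fun y => leading_density r (U n) y / r%:R)].
  have Kr0 : 0 <= K * r%:R by rewrite mulr_ge0.
  (* The threshold [K * r%:R / n.+1%:R < 1] is the independence condition of
     [near_orthogonal_row_free], divided by [dimN d n]. *)
  apply: filterS (near_inv_lt Kr0 ltr01) => n Kn.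
  have N0 := dimN_gt0 R d n.
  have Kn0 : 0 <= K / n.+1%:R by rewrite divr_ge0.
  have TE := moment_matrix_discrete Tx xinj lam n.
  have Efree : row_free ((evec_mx x n)^t*).
    apply: (@near_orthogonal_row_free R _ _ _ (dimN d n)%:R
      ((dimN d n)%:R * (K / n.+1%:R))).
    - by rewrite mulr_ge0// ltW.
    - by rewrite -mulrA gtr_pMr// mulrAC.
    - by move=> k; rewrite gram_dirichlet dirichlet0.
    - by move=> k l kl; rewrite gram_dirichlet; exact: HK.
  have [Uu _ _ _ _] := svd n.
  have := svd n; rewrite TE => /svd_rank_factor - /(_ Efree)[j|rk U0].
    by rewrite mxE.
  have rN : (r <= dimN d n)%N by rewrite -[leqLHS]rk rank_leq_row.
  split.
  - exact: tbm_leading_density.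
  - exact: torus_integral_leading_density.
  - move=> y; rewrite mulrAC; apply: fejer_le_leading_density => //.
    exact: HK.
  - by apply: p1_normalized => //; rewrite TE.
have Kr0 : 0 <= K * r%:R by rewrite mulr_ge0.
have gQ : \forall n \near \oo, [/\ torus_bounded_measurable (leading_density r (U n)),
     torus_integral (leading_density r (U n)) = r%:R &
     forall y, \sum_j fejer n (x j) y <=
       (1 + K * r%:R / n.+1%:R) * leading_density r (U n) y].
  by apply: filterS good => n [].
apply: cvg_complex => e e0.
have HRe := @density_cvg R d r x _ _ _ r0 Kr0 Tx gQ cRe e e0.
have HIm := @density_cvg R d r x _ _ _ r0 Kr0 Tx gQ cIm e e0.
(* The density and the weights are real, so real and imaginary parts of [f] separate. *)
apply: filterS3 good HRe HIm => n [_ _ _ pE] hRe hIm.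
have pEy y : p1 mu (U n) y / L1norm (p1 mu (U n)) =
    leading_density r (U n) y / r%:R by exact: (congr1 (@^~ y) pE).
split.
- rewrite Re_sum /=.
  rewrite (eq_bigr (fun j => r%:R^-1 * complex.Re (f (x j)))) => [|j _]; last first.
    by case: (f (x j)) => a b /=; rewrite mul0r subr0.
  apply: le_lt_trans hRe; rewrite le_eqVlt; apply/orP; left; apply/eqP.
  congr (`|_ - _|); apply: eq_Rintegral => y _; rewrite pEy.
  by case: (f y) => a b /=; rewrite mulr0 subr0.
- rewrite Im_sum /=.
  rewrite (eq_bigr (fun j => r%:R^-1 * complex.Im (f (x j)))) => [|j _]; last first.
    by case: (f (x j)) => a b /=; rewrite mul0r addr0.
  apply: le_lt_trans hIm; rewrite le_eqVlt; apply/orP; left; apply/eqP.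
  congr (`|_ - _|); apply: eq_Rintegral => y _; rewrite pEy.
  by case: (f y) => a b /=; rewrite mulr0 add0r.
Qed.
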